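(* Let $\{X_n\}_{n\in\mathbb Z}$ be a stationary and ergodic finitarily Markovian process with values in a finite or countably infinite alphabet $\mathcal X$. Let $\epsilon>0$ be fixed, and let $\mathcal N$ and $\rho_n$ be as constructed in the context (from $\epsilon$, $\gamma$, $\beta$ and the list of words). Then: (i) almost surely, $\rho_n=K(X_{-\infty}^n)$ for all sufficiently large $n\in\mathcal N$; (ii) almost surely, $$\liminf_{n\to\infty}\frac{|\mathcal N\cap\{0,1,\dots,n-1\}|}{n}\ge 1-\epsilon;$$ (iii) almost surely, for all sufficiently large $n\in\mathcal N$, the string $X_{n-\rho_n+1}^n$ appears at least $n^{1-\gamma}$ times in $X_0^n$.
   Context: Notation: $X_m^n=(X_m,\dots,X_n)$ for $m\le n$, and $X_m^n$ is the empty string if $m>n$; similarly for deterministic strings. $p(x_{-k}^0)=P(X_{-k}^0=x_{-k}^0)$ and $p(y|x_{-k}^0)=P(X_1=y\mid X_{-k}^0=x_{-k}^0)$; for the empty string $\emptyset$, $p(\emptyset)=1$ and $p(y|\emptyset)=P(X_1=y)$. Memory length: $K(X_{-\infty}^0)$ is the smallest $0\le K<\infty$ such that for all $i\ge1$, $y\in\mathcal X$, $z_{-K-i+1}^{-K}\in\mathcal X^i$ one has $p(y|X_{-K+1}^0)=p(y|z_{-K-i+1}^{-K},X_{-K+1}^0)$ provided $p(z_{-K-i+1}^{-K},X_{-K+1}^0,y)>0$; $K(X_{-\infty}^0)=\infty$ if there is no such $K$. $K(X_{-\infty}^n)$ is the same function applied to the past of time $n$ (i.e. to the shifted sequence). The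 process is finitarily Markovian if $K(X_{-\infty}^0)<\infty$ almost surely. Backward test (a function of $X_{-n}^0$): for $w_{-k+1}^0\in\mathcal X^k$ and $x\in\mathcal X$, $$\hat p_n(x|w_{-k+1}^0)=\frac{\#\{-n+k-1\le t\le -1: X_{t-k+1}^{t+1}=(w_{-k+1}^0,x)\}}{\#\{-n+k-1\le t\le -1: X_{t-k+1}^{t}=w_{-k+1}^0\}}.$$ Fix $0<\gamma<1$ and $0<\beta<\frac{1-\gamma}{2}$. Let $$\mathcal L_k^n=\{x_{-k}^0\in\mathcal X^{k+1}: \#\{-n+k\le t\le 0: X_{t-k}^t=x_{-k}^0\}>n^{1-\gamma}\},$$ $$\hat\Delta_k^n(w_{-k+1}^0)=\max_{1\le i\le n}\ \max_{(z_{-k-i+1}^{-k},w_{-k+1}^0,x)\in\mathcal L_{k+i}^n}\left|\hat p_n(x|w_{-k+1}^0)-\hat p_n(x|z_{-k-i+1}^{-k},w_{-k+1}^0)\right|,$$ where the maximum is over $i$, $z_{-k-i+1}^{-k}\in\mathcal X^i$ and $x\in\mathcal X$ with the displayed membership, and $\hat\Delta_k^n(w_{-k+1}^0)=0$ if there are no such triples. Set $NTEST_n(w_{-k+1}^0)=YES$ if $\hat\Delta_k^n(w_{-k+1}^0)\le n^{-\beta}$ and $NO$ otherwise. Forward test: $PTEST_n(w_{-k+1}^0)$ is the function of $X_0^n$ obtained by applying $NTEST_n(w_{-k+1}^0)$ to the data segment $X_0^n$ in place of $X_{-n}^0$ (that is, with $X_{n+j}$ in place of $X_j$ for $-n\le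 j\le 0$). Construction: let $w(0),w(1),w(2),\dots$ be a list of all finite words over $\mathcal X$ of all lengths such that no word precedes any of its suffixes; $w(0)$ is the empty word; $|w|$ is the length of $w$. Let $A_n^0=\{0,1,\dots,n\}$ and for $i>0$, $A_n^i=\{|w(i)|-1\le j\le n: X_{j-|w(i)|+1}^j=w(i)\}$. Let $\theta_n=\theta_n(\epsilon)<n$ be the minimal $j$ such that $$\frac{\left|\bigcup_{i\le j:\,PTEST_n(w(i))=YES}A_n^i\right|}{n+1}\ge 1-\epsilon/2,$$ and $\theta_n=n$ if no such $j$ exists. Let $\mathcal N$ be the (random) set of those $n$ for which $n\in\bigcup_{i\le\theta_n,\ PTEST_n(w(i))=YES}A_n^i$. For $n\in\mathcal N$ put $\kappa_n=\min\{i\ge0: X_{n-|w(i)|+1}^n=w(i),\ PTEST_n(w(i))=YES\}$ and $\rho_n=\rho_n(X_0^n)=|w(\kappa_n)|$. *)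

(* Defs.v *)
From HB Require Import structures.
From mathcomp Require Import all_boot all_order all_algebra.
From mathcomp Require Import all_classical all_reals all_analysis.
Set Implicit Arguments.
Unset Strict Implicit.
Unset Printing Implicit Defensive.
Import Order.TTheory GRing.Theory Num.Theory.
Local Open Scope classical_set_scope.
Local Open Scope ring_scope.

(* The integers m, m + 1, ..., n in increasing order; empty if m > n. *)
Definition zrange (m n : int) : seq int :=
  if m <= n then mkseq (fun i => m + i%:Z) `|n - m|%N.+1 else [::].

(* The minimum of a set of naturals; None stands for "infinity" (empty set). *)
Definition least (Q : nat -> Prop) : option nat :=
  if pselect (exists k, `[< Q k >]) is left exQ then Some (ex_minn exQ)
  else None.

Section Sequences.
Context {A : countType}.
Implicit Types (x : int -> A) (v w : seq A) (m n : int).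

(* x_m^n; words are listed from the oldest letter to the most recent one. *)
Definition str x m n : seq A := [seq x t | t <- zrange m n].

Definition time_shift m x : int -> A := fun j => x (m + j).

(* #{m + |v| - 1 <= t <= n : x_(t-|v|+1)^t = v}; the empty word is thus counted
   at each of the n - m + 2 gaps of x_m^n (when m <= n + 1). *)
Definition occ v x m n : nat :=
  count (fun t => str x (t - (size v)%:Z + 1) t == v)
        (zrange (m + (size v)%:Z - 1) n).

(* Product sigma-algebra on the space of two-sided sequences; A is discrete. *)
Definition path_sigma : set (set (int -> A)) :=
  <<s [set B | exists n a, B = [set x | x n = a]] >>.

End Sequences.

Section Process.
Context {d : measure_display} {T : measurableType d} {R : realType}.
Context {A : countType}.
Variables (P : probability T R) (X : int -> T -> A).
Implicit Types (v : seq A) (x : int -> A) (y : A).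

Definition traj (t : T) : int -> A := fun n => X n t.

Definition is_process : Prop :=
  forall (n : int) (a : A), measurable [set t | X n t = a].

Definition stationary : Prop := forall B, path_sigma B ->
  P (traj @^-1` (time_shift 1 @^-1` B)) = P (traj @^-1` B).

Definition ergodic : Prop := forall B, path_sigma B ->
  time_shift 1 @^-1` B = B ->
  P (traj @^-1` B) = 0%E \/ P (traj @^-1` B) = 1%E.

Definition ending_at0 v : set T :=
  [set t | str (traj t) (- (size v)%:Z + 1) 0 = v].

Definition prob v : R := fine (P (ending_at0 v)).

Definition cprob y v : R :=
  fine (P ([set t | X 1 t = y] `&` ending_at0 v)) / prob v.

Definition is_memory x (K : nat) : Prop :=
  let u := str x (- K%:Z + 1) 0 in
  forall (z : seq A) (y : A), (1 <= size z)%N ->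
    0 < prob (z ++ rcons u y) -> cprob y u = cprob y (z ++ u).

(* None encodes infinite memory length. *)
Definition memory_length x : option nat := least (is_memory x).

Definition finitarily_markovian : Prop :=
  {ae P, forall t, memory_length (traj t) <> None}.

End Process.

Section Tests.
Context {R : realType} {A : countType}.
Variables (gamma beta : R).
Implicit Types (n : nat) (x : int -> A) (v w : seq A) (a : A).

Definition phat n x a w : R :=
  let k := (size w)%:Z in
  (count (fun t => str x (t - k + 1) (t + 1) == rcons w a)
         (zrange (- n%:Z + k - 1) (- 1)))%:R
  / (count (fun t => str x (t - k + 1) t == w)
           (zrange (- n%:Z + k - 1) (- 1)))%:R.

(* Membership of x_(-k)^0 in L_k^n, with k + 1 the length of the word. *)
Definition in_L n x v : bool :=
  n%:R `^ (1 - gamma) < (occ v x (- n%:Z) 0)%:R.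

(* Only words occurring in x_(-n)^0 belong to L, so the set below is finite and
   its supremum is a maximum; sup set0 = 0. *)
Definition Delta_hat n x w : R :=
  sup [set e | exists (z : seq A) (a : A),
    [/\ (1 <= size z <= n)%N, in_L n x (z ++ rcons w a)
      & e = `|phat n x a w - phat n x a (z ++ w)| ]].

Definition NTEST n x w : bool := Delta_hat n x w <= n%:R `^ (- beta).

Definition PTEST n x w : bool := NTEST n (time_shift n%:Z x) w.

End Tests.

(* No word precedes any of its suffixes. *)
Definition word_list (A : countType) (w : nat -> seq A) : Prop :=
  [/\ w 0%N = [::], injective w, forall v, exists i, w i = v
    & forall i j, suffix (w i) (w j) -> (i <= j)%N].

Section Construction.
Context {R : realType} {A : countType}.
Variables (gamma beta eps : R) (w : nat -> seq A).
Implicit Types (n i j : nat) (x : int -> A).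

Definition Aset n x i : {set 'I_n.+1} :=
  if i == 0%N then [set: 'I_n.+1]%SET
  else [set j : 'I_n.+1 | ((size (w i))%:Z - 1 <= j%:Z)
         && (str x (j%:Z - (size (w i))%:Z + 1) j%:Z == w i)]%SET.

Definition covered n x j : {set 'I_n.+1} :=
  (\bigcup_(i < j.+1 | PTEST gamma beta n x (w i)) Aset n x i)%SET.

(* find on iota 0 n returns the least suitable j < n, and n if there is none. *)
Definition theta n x : nat :=
  find (fun j => 1 - eps / 2 <= #|covered n x j|%:R / n.+1%:R) (iota 0 n).

Definition calN x n : bool := ord_max \in covered n x (theta n x).

(* The default value 0 is irrelevant: the set is nonempty for n in calN. *)
Definition kappa n x : nat :=
  odflt 0%N (least (fun i =>
    (str x (n%:Z - (size (w i))%:Z + 1) n%:Z = w i)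
    /\ PTEST gamma beta n x (w i))).

Definition rho n x : nat := size (w (kappa n x)).

End Construction.

(* Main.v *)
Require Import Defs.
From HB Require Import structures.
From mathcomp Require Import all_boot all_order all_algebra.
From mathcomp Require Import all_classical all_reals all_analysis.
From mathcomp Require Import measurable_realfun.
From mathcomp Require Import lra ring zify.
Import Order.TTheory GRing.Theory Num.Theory.
Import numFieldNormedType.Exports.
Local Open Scope classical_set_scope.
Local Open Scope ring_scope.

(** A word [u] is a memory word if the law of the next letter given [u] does not
    change when [u] is extended into the past; the memory length of a past is the
    length of the shortest memory word that ends it.  The proof rests on three
    facts.

    Frequencies converge.  By the ergodic theorem for indicators
    ([birkhoff_frequency]), almost surely every word occurs with a frequency equal
    to its probability, and so does every finite union of such events.

    The test is eventually right about each fixed word.  If [w] is not a memory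
    word, some [z] and [y] witness it, and the frequencies of [y] after [w] and
    after [z ++ w] converge to different limits ([test_rejects]).  If [w] is a
    memory word ([memory_word_test]), the error must be controlled for all
    extensions [u] of [w] and all letters [a] at once, and there may be infinitely
    many of them.  After every occurrence of [u] the next letter is [a] with the
    same conditional probability, so exponentials of the centred counts are
    supermartingales.  Such an exponential equals [1] until [u] has occurred;
    hence the expectation that it carries on the event that [u a] occurs is at most
    a polynomial in [n] times the probability of the word [u a]
    ([expect_weight_follows]).  These probabilities add up to one over all words of
    a given length, so the union bound over the infinitely many pairs [(u, a)]
    costs only a polynomial factor.  With more than [n ^ (1 - gamma)] occurrences
    and a deviation of order [n ^ (- beta)], the exponential gain is
    [exp (- n ^ (1 - gamma - 2 beta) / 32)], and Borel-Cantelli applies.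

    Only finitely many words matter.  Let [p_j] be the probability that the past
    ends with a memory word among [w 0, ..., w j].  Finite memory gives [p_j --> 1]
    ([remembered_prob_large]).  Choose [J] with [p_J > 1 - eps / 2] and the least
    [J0] with [p_J0 > 1 - eps].  By convergence of frequencies, [J0 <= theta <= J]
    for all large [n] ([theta_ge], [theta_le]); [theta] itself need not converge, as
    some [p_j] may equal [1 - eps / 2].  The upper bound confines [kappa] to the
    finitely many words [w 0, ..., w J], on which the tests are right, and since
    suffixes precede words in the list, [w kappa] is the shortest memory word that
    ends the past; it occurs with positive frequency, hence more than
    [n ^ (1 - gamma)] times.  The lower bound puts every time at which one of the
    memory words among [w 0, ..., w J0] ends into the set [calN], whose density is
    therefore at least [p_J0]. *)

(** * The ergodic theorem for indicators *)

Section Birkhoff.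
Context {d : measure_display} {Om : measurableType d} {R : realType}.
Variables (mu : probability Om R) (tau : Om -> Om).
Hypothesis measurable_tau : measurable_fun setT tau.
Hypothesis tau_preserves :
  forall B, measurable B -> mu (tau @^-1` B) = mu B.
Hypothesis tau_ergodic :
  forall B, measurable B -> tau @^-1` B = B -> mu B = 0%E \/ mu B = 1%E.
Implicit Types (B : set Om) (x : Om) (n : nat) (c : R).

Definition visits B n x : nat := (\sum_(j < n) (iter j tau x \in B))%N.

(** This set stands in for the points at which the upper density of the visits
    exceeds [c]: it contains them, and it is easier to see that it is invariant. *)
Definition excess B c : set Om :=
  [set x | forall M : nat, exists n, M%:R + c * n%:R < (visits B n x)%:R].

Lemma visitsS B n x : visits B n.+1 x = ((x \in B) + visits B n (tau x))%N.
Proof.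
rewrite /visits big_ord_recl /=; congr (_ + _)%N.
by apply: eq_bigr => i _; rewrite -iterS iterSr.
Qed.

Lemma visits_le B n x : (visits B n x <= n)%N.
Proof.
rewrite /visits -[leqRHS]card_ord -sum1_card.
by apply: leq_sum => i _; case: (_ \in _).
Qed.

Lemma visitsD B m n x :
  visits B (m + n) x = (visits B m x + visits B n (iter m tau x))%N.
Proof.
elim: m x => [|m IH] x; first by rewrite /visits big_ord0.
by rewrite addSn !visitsS IH iterSr addnA.
Qed.

Lemma visitsC B n x : (visits B n x + visits (~` B) n x = n)%N.
Proof.
elim: n x => [|n IH] x; first by rewrite /visits !big_ord0.
rewrite !visitsS addnACA IH.
by case: (asboolP (B x)) => Bx; [rewrite mem_set// memNset|rewrite memNset// mem_set];
  rewrite //= => /(_ Bx).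
Qed.

Lemma visits_subset B B' n x : B `<=` B' -> (visits B n x <= visits B' n x)%N.
Proof.
move=> BB'; rewrite /visits; apply: leq_sum => i _.
by have [/set_mem /BB' /mem_set ->|] := boolP (_ \in B).
Qed.

Lemma measurable_visits B n (Q : set nat) :
  measurable B -> measurable [set x | Q (visits B n x)].
Proof.
move=> mB; elim: n Q => [|n IH] Q.
  rewrite (_ : [set x | _] = [set x | Q 0%N]); last first.
    by apply/seteqP; split => x /=; rewrite /visits big_ord0.
  have [Q0|Q0] := pselect (Q 0%N).
    by rewrite (_ : [set x | _] = setT)//; apply/seteqP; split.
  by rewrite (_ : [set x | _] = set0)//; apply/seteqP; split.
have mtau (Q' : set nat) : measurable (tau @^-1` [set x | Q' (visits B n x)]).
  by rewrite -[X in measurable X]setTI; apply: measurable_tau => //; apply: IH.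
rewrite (_ : [set x | _] =
  (B `&` tau @^-1` [set x | [set m | Q m.+1] (visits B n x)]) `|`
  (~` B `&` tau @^-1` [set x | Q (visits B n x)])).
  apply: measurableU; apply: measurableI; [by []|exact: mtau| |exact: mtau].
  exact: measurableC.
apply/seteqP; split => x /=; rewrite visitsS.
  by case: (asboolP (B x)) => Bx; [rewrite mem_set// => ?; left|rewrite memNset// => ?; right].
case=> -[Bx]; first by rewrite mem_set.
by rewrite memNset.
Qed.

Lemma measurable_fun_visits B n : measurable B ->
  measurable_fun setT (fun x => ((visits B n x)%:R)%:E : \bar R).
Proof.
move=> mB; apply/measurable_EFinP => _ Y _; rewrite setTI.
exact: (measurable_visits _ _ (fun m => Y m%:R)).
Qed.

Lemma measurable_excess B c : measurable B -> measurable (excess B c).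
Proof.
move=> mB; rewrite (_ : excess B c =
   \bigcap_(M in setT) \bigcup_(n in setT)
     [set x | [set m : nat | M%:R + c * n%:R < m%:R] (visits B n x)]).
  apply: bigcapT_measurable => M; apply: bigcupT_measurable => n.
  exact: measurable_visits.
apply/seteqP; split => [x xE M _|x xE M]; have [] := xE M => //.
  by move=> n ?; exists n.
by move=> n _ /= ?; exists n.
Qed.

(** A bounded change of the excess does not affect its unboundedness, so the
    set is exactly invariant and not only up to a null set. *)
Lemma excess_invariant B c : tau @^-1` excess B c = excess B c.
Proof.
have [b cb] : exists b : nat, `|c| <= b%:R.
  by exists (Num.bound `|c|); rewrite ltW// archi_boundP.
have cbN : - c <= b%:R by rewrite (le_trans (ler_norm _))// normrN.
have cbP : c <= b%:R by rewrite (le_trans (ler_norm _)).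
apply/seteqP; split => x /= xE M.
  have [n nE] := xE (M + b)%N; exists n.+1; rewrite visitsS.
  rewrite natrD -[n.+1]addn1 natrD mulrDr mulr1.
  rewrite natrD in nE.
  by have := ler0n R (x \in B); lra.
have [[|n] nE] := xE (M + b + 1)%N.
  have := ler0n R (M + b + 1); rewrite /visits big_ord0 mulr0 addr0 in nE.
  by move: nE; rewrite ltrn0.
exists n; rewrite visitsS 2!natrD -[n.+1]addn1 natrD mulrDr mulr1 in nE.
rewrite natrD in nE.
have : ((x \in B)%:R <= 1 :> R) by case: (_ \in _); rewrite ?ler01.
lra.
Qed.

Lemma measurable_iter j : measurable_fun setT (iter j tau).
Proof.
elim: j => [|j IH] //=; first exact: measurable_id.
exact: (measurableT_comp measurable_tau).
Qed.

Lemma iter_preserves j B : measurable B -> mu (iter j tau @^-1` B) = mu B.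
Proof.
elim: j B => [//|j IH] B mB.
rewrite -[RHS]tau_preserves// -[RHS]IH//.
by rewrite -[X in measurable X]setTI; exact: measurable_tau.
Qed.

Lemma integral_visits B n : measurable B ->
  (\int[mu]_x ((visits B n x)%:R)%:E = n%:R%:E * mu B)%E.
Proof.
move=> mB.
have visitsE x : ((visits B n x)%:R%:E =
    \sum_(j < n) (\1_(iter j tau @^-1` B) x)%:E :> \bar R)%E.
  rewrite /visits natr_sum -sumEFin; apply: eq_bigr => j _.
  by rewrite indicE; congr (_%:R%:E); congr nat_of_bool; apply/idP/idP; rewrite !inE.
under eq_integral do rewrite visitsE.
have mpre (j : nat) : measurable (iter j tau @^-1` B).
  by rewrite -[X in measurable X]setTI; exact: measurable_iter.
rewrite ge0_integral_sum//; last first.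
  by move=> j; apply/measurable_EFinP; apply: measurable_indic.
rewrite (eq_bigr (fun=> mu B)); last first.
  by move=> j _; rewrite integral_indic// setIT; exact: iter_preserves.
by rewrite sumr_const card_ord mule_natl.
Qed.

(** The argument of Katznelson and Weiss.  If the excess were unbounded almost
    everywhere, almost every point would start a block of visits of density more
    than [c], and one of length at most [M] outside of a small set.  Counting the
    points of that small set as visits, any long orbit segment is tiled by such
    blocks up to its last [M] steps, so the enlarged set would have measure at
    least [c]. *)
Lemma excess_null B c : measurable B -> (mu B < c%:E)%E ->
  mu (excess B c) = 0%E.
Proof.
move=> mB muBc.
have [//|muE1] := tau_ergodic _ (measurable_excess _ c mB) (excess_invariant _ _).
have c_gt0 : 0 < c by rewrite -lte_fin (le_lt_trans _ muBc).
pose V (M : nat) := [set x | exists n, [/\ (0 < n <= M)%N & c * n%:R < (visits B n x)%:R]].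
have mV M : measurable (V M).
  rewrite (_ : V M = \bigcup_(n in [set n | (0 < n <= M)%N])
     [set x | [set m : nat | c * n%:R < m%:R] (visits B n x)]).
    by apply: bigcup_measurable => n _; exact: measurable_visits.
  by apply/seteqP; split => [x [n [? ?]]|x [n ? ?]]; exists n.
have V_nd : nondecreasing_seq V.
  move=> M N MN; apply/subsetPset => x [n [/andP[n0 nM] ?]].
  by exists n; rewrite n0 (leq_trans nM).
have E_V : excess B c `<=` \bigcup_M V M.
  move=> x /(_ 0%N)[n]; rewrite add0r => nE; exists n => //; exists n.
  split=> //; rewrite leqnn andbT lt0n; apply/eqP => n0.
  by move: nE; rewrite n0 /visits big_ord0 mulr0 ltxx.
have mUV : measurable (\bigcup_M V M) by exact: bigcupT_measurable.
have muV1 : mu (\bigcup_M V M) = 1%E.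
  apply/eqP; rewrite eq_le probability_le1//= -muE1 le_measure ?inE//.
  exact: measurable_excess.
have cvgV : mu (V M) @[M --> \oo] --> 1%:E.
  by rewrite -muV1; exact: nondecreasing_cvg_mu.
have [M muVM] : exists M, (mu (B `|` ~` V M) < c%:E)%E.
  have bc : 1 - (c - fine (mu B)) < 1.
    by rewrite gtrBl subr_gt0 -lte_fin fineK// fin_num_measure.
  have /filter_ex[M /= HM] :
      \forall M \near \oo, 1 - (c - fine (mu B)) < fine (mu (V M)).
    by apply: cvgr_gt bc; exact: fine_cvg.
  exists M.
  have mVC : measurable (~` V M) by exact: measurableC.
  have : (mu (B `|` ~` V M) <= mu B + mu (~` V M))%E by exact: measureU2.
  move=> /le_lt_trans; apply.
  rewrite probability_setC// -[mu B]fineK ?fin_num_measure//.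
  rewrite -[mu (V M)]fineK ?fin_num_measure// -EFinB -EFinD lte_fin.
  by lra.
have c_le1 : c <= 1.
  rewrite leNgt; apply/negP => c_gt1.
  suff V0 : \bigcup_M V M = set0.
    by move: muV1; rewrite V0 measure0 => /eqP; rewrite eq_sym onee_eq0.
  apply/seteqP; split => // x [N _ [n [/andP[n0 _]]]].
  rewrite ltNge => /negP; apply.
  rewrite (@le_trans _ _ n%:R)// ?ler_nat ?visits_le//.
  by rewrite ler_peMl// ltW.
set B' := B `|` ~` V M in muVM.
(* tiling: a short rich block if there is one, else a single step *)
have key L x : c * L%:R <= (visits B' L x)%:R + c * M%:R.
  elim/ltn_ind: L x => L IH x.
  have [LM|ML] := leqP L M.
    by rewrite ler_wpDl// ler_wpM2l ?ler_nat// ltW.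
  have [Vx|nVx] := pselect (V M x).
    have [n [/andP[n0 nM] cn]] := Vx.
    have nL : (n <= L)%N by rewrite (leq_trans nM)// ltnW.
    have := IH (L - n)%N _ (iter n tau x).
    rewrite ltn_subrL n0 (leq_trans n0)// => /(_ isT).
    have visL := visitsD B' n (L - n) x; rewrite subnKC// in visL.
    rewrite visL natrB// natrD mulrBr.
    have : (visits B n x <= visits B' n x)%N.
      by apply: visits_subset => y; left.
    by rewrite -(ler_nat R); lra.
  case: L => [//|L] in IH ML *.
  have := IH L (ltnSn L) (tau x).
  rewrite visitsS mem_set; last by right.
  by rewrite add1n -!natr1 mulrDr; lra.
have mB' : measurable B' by apply: measurableU => //; exact: measurableC.
have bound L : (c * L%:R <= L%:R * fine (mu B') + c * M%:R).
  rewrite -lee_fin [leRHS]EFinD [(_ * fine _)%:E]EFinM fineK ?fin_num_measure//.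
  rewrite -integral_visits//.
  rewrite -[leLHS]mule1 -[(c * M%:R)%:E]mule1 -(probability_setT mu).
  rewrite -!integral_cst// -ge0_integralD//; last 2 first.
  - exact: measurable_fun_visits.
  - by move=> x _ /=; rewrite lee_fin mulr_ge0// ltW.
  apply: ge0_le_integral => //.
  - by move=> x _ /=; rewrite lee_fin mulr_ge0// ltW.
  - by apply: emeasurable_funD => //; exact: measurable_fun_visits.
  by move=> x _ /=; rewrite -EFinD lee_fin.
have gap : 0 < c - fine (mu B').
  by rewrite subr_gt0 -lte_fin fineK// fin_num_measure.
have [L LM] : exists L : nat, c * M%:R / (c - fine (mu B')) < L%:R.
  exists (Num.bound (c * M%:R / (c - fine (mu B')))); apply: archi_boundP.
  by rewrite divr_ge0 ?mulr_ge0// ltW.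
exfalso; have := bound L; rewrite ltr_pdivrMr// in LM; lra.
Qed.

Lemma ae_excess B : measurable B -> {ae mu, forall x,
  forall k : nat, ~ excess B (fine (mu B) + k.+1%:R^-1) x}.
Proof.
move=> mB; apply/ae_foralln => k.
exists (excess B (fine (mu B) + k.+1%:R^-1)); split.
- exact: measurable_excess.
- apply: excess_null => //.
  by rewrite -[mu B]fineK ?fin_num_measure// lte_fin ltrDl.
- by move=> x /= /contrapT.
Qed.

(** Birkhoff's ergodic theorem for indicators: the excess of [B] over the
    proportion [c] is bounded for all [c > mu B], and the same for the
    complement of [B] gives the bound from below. *)
Theorem birkhoff_frequency B : measurable B -> {ae mu, forall x,
  (visits B n x)%:R / n%:R @[n --> \oo] --> fine (mu B)}.
Proof.
move=> mB; have mBC : measurable (~` B) by exact: measurableC.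
apply: filterS2 (ae_excess _ mB) (ae_excess _ mBC) => x xB xBC.
have muC : fine (mu (~` B)) = 1 - fine (mu B).
  by rewrite probability_setC// fineB// fin_num_measure.
rewrite muC in xBC.
apply/cvgrPdist_lt => /= e e_gt0.
have [k ke] : exists k : nat, k.+1%:R^-1 < e / 2 :> R.
  have e2 : 0 < (e / 2)^-1 by rewrite invr_gt0 divr_gt0.
  exists (Num.bound (e / 2)^-1); rewrite -[ltRHS]invrK ltf_pV2 ?posrE//.
  by rewrite (lt_le_trans (archi_boundP (ltW e2)))// ler_nat.
have bound c D : ~ excess D c x ->
    exists M : nat, forall n, (visits D n x)%:R <= M%:R + c * n%:R.
  move=> /existsNP[M /forallNP HM]; exists M => n.
  by rewrite leNgt; apply/negP; exact: HM.
have [M1 HM1] := bound _ _ (xB k).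
have [M2 HM2] := bound _ _ (xBC k).
have M12 : 0 <= (M1 + M2)%:R / (e / 2) by rewrite divr_ge0// ltW// divr_gt0.
near=> n.
have n_gt0 : (0 < n)%N by near: n; exact: nbhs_infty_gt.
have nM : (M1 + M2)%:R / (e / 2) < n%:R.
  by near: n; exact: nbhs_infty_gtr.
rewrite ltr_pdivrMr ?divr_gt0// natrD in nM.
have ken : k.+1%:R^-1 * n%:R <= e / 2 * n%:R by rewrite ler_wpM2r// ltW.
have n0 : 0 < n%:R :> R by rewrite ltr0n.
have visC : (visits (~` B) n x)%:R = n%:R - (visits B n x)%:R :> R.
  by apply/eqP; rewrite eq_sym subr_eq -natrD addnC visitsC eqxx.
have := HM1 n; have := HM2 n; rewrite visC.
have := ler0n R M1; have := ler0n R M2.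
set v := _ / n%:R; have -> : (visits B n x)%:R = v * n%:R.
  by rewrite divfK// gt_eqF.
move: ken; set h := k.+1%:R^-1 => *.
rewrite ltr_norml; apply/andP; split; rewrite -(ltr_pM2r n0); lra.
Unshelve. all: by end_near.
Qed.

End Birkhoff.

(** * Words and their occurrences *)

Section Words.
Context {A : countType}.
Implicit Types (u v s : seq A) (a b : A) (x : int -> A) (n j : nat).

Definition initial x n : seq A := mkseq (fun i => x i%:Z) n.

(** Only the occurrences of [u] that are followed by a letter of [s] count: these
    are the trials of which [follows] counts the outcomes [a]. *)
Definition hits u s : nat := (\sum_(j < size s) suffix u (take j s))%N.

Definition follows u a s : nat :=
  (\sum_(j < size s) suffix (rcons u a) (take j.+1 s))%N.

Lemma size_initial x n : size (initial x n) = n.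
Proof. exact: size_mkseq. Qed.

Lemma initialS x n : initial x n.+1 = rcons (initial x n) (x n%:Z).
Proof. exact: mkseqS. Qed.

Lemma take_initial x n j : (j <= n)%N -> take j (initial x n) = initial x j.
Proof. by move=> jn; rewrite /initial /mkseq -map_take take_iota (minn_idPl jn). Qed.

Lemma hits_rcons u s b : hits u (rcons s b) = (hits u s + suffix u s)%N.
Proof.
rewrite /hits size_rcons big_ord_recr /= -cats1 take_size_cat//; congr (_ + _)%N.
by apply: eq_bigr => i _; rewrite takel_cat// ltnW.
Qed.

Lemma follows_rcons u a s b :
  follows u a (rcons s b) = (follows u a s + (suffix u s && (a == b)))%N.
Proof.
rewrite /follows size_rcons big_ord_recr /= take_oversize ?size_rcons//.
rewrite suffix_rcons andbC; congr (_ + _)%N.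
by apply: eq_bigr => i _; rewrite -[rcons s b]cats1 takel_cat.
Qed.

Lemma hits_initial u x n :
  hits u (initial x n) = (\sum_(j < n) suffix u (initial x j))%N.
Proof.
rewrite /hits size_initial; apply: eq_bigr => j _.
by rewrite take_initial// ltnW.
Qed.

Lemma follows_initial u a x n : follows u a (initial x n) =
  (\sum_(j < n) suffix (rcons u a) (initial x j.+1))%N.
Proof.
by rewrite /follows size_initial; apply: eq_bigr => j _; rewrite take_initial.
Qed.

Lemma follows_hits u a s : (follows u a s <= hits u s)%N.
Proof.
elim/last_ind: s => [|s b IH]; first by rewrite /follows big_ord0.
rewrite follows_rcons hits_rcons leq_add//.
by case: (suffix u s); case: (a == b).
Qed.

Lemma follows_suffix u v a s : suffix u v -> (follows v a s <= follows u a s)%N.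
Proof.
move=> uv; apply: leq_sum => j _.
have uav : suffix (rcons u a) (rcons v a) by rewrite suffix_rcons eqxx.
by have [/(suffix_trans uav) ->|] := boolP (suffix (rcons v a) _).
Qed.

Lemma hits_infix u s : ~~ infix u s -> hits u s = 0%N.
Proof.
move=> us; apply: big1 => j _; apply/eqP; rewrite eqb0.
by apply: contra us => /suffixW/infix_trans; apply; exact: infix_take.
Qed.

Lemma follows_infix u a s : (0 < follows u a s)%N -> infix (rcons u a) s.
Proof.
apply: contraTT => us; rewrite -leqNgt leqn0; apply/eqP/big1 => j _.
apply/eqP; rewrite eqb0.
by apply: contra us => /suffixW/infix_trans; apply; exact: infix_take.
Qed.

Lemma zrange_addn (m : int) l : zrange m (m + l%:Z - 1) = mkseq (fun i => m + i%:Z) l.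
Proof.
rewrite /zrange; case: l => [|l].
  by rewrite ifF//; apply/negbTE; lia.
by rewrite ifT; [congr mkseq|]; lia.
Qed.

Lemma zrange_nil (m n : int) : n < m -> zrange m n = [::].
Proof. by move=> nm; rewrite /zrange leNgt nm. Qed.

Lemma le_addn (m n : int) : m <= n -> exists l, n = m + l%:Z - 1.
Proof. by move=> mn; exists `|n - m|%N.+1; lia. Qed.

Lemma str_addn x (m : int) l :
  str x m (m + l%:Z - 1) = mkseq (fun i => x (m + i%:Z)) l.
Proof. by rewrite /str zrange_addn /mkseq -map_comp. Qed.

Lemma count_zrange (p : pred int) (m : int) l :
  count p (zrange m (m + l%:Z - 1)) = (\sum_(j < l) p (m + j%:Z)%R)%N.
Proof.
rewrite zrange_addn; elim: l => [|l IH]; first by rewrite big_ord0.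
by rewrite mkseqS -cats1 count_cat IH big_ord_recr /= addn0.
Qed.

Lemma str_shift x (k m n : int) :
  str (time_shift k x) m n = str x (k + m) (k + n).
Proof.
have [mn|nm] := leP m n; last by rewrite /str !zrange_nil// ltrD2l.
have [l ->] := le_addn _ _ mn.
rewrite str_addn addrA addrA str_addn; apply: eq_mkseq => i.
by rewrite /time_shift addrA.
Qed.

(** Being a suffix of the first [j] letters includes the condition that the word
    fits into the window, so no boundary case is left in the counts below. *)
Lemma suffix_initial v x j : suffix v (initial x j) =
  (size v <= j)%N && (str x (j%:Z - (size v)%:Z) (j%:Z - 1) == v).
Proof.
have [vj|jv] := leqP (size v) j; last first.
  by apply/negbTE; apply: contraL jv => /size_suffix; rewrite size_initial -leqNgt.
have -> : j%:Z - 1 = (j%:Z - (size v)%:Z) + (size v)%:Z - 1 by lia.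
rewrite suffixE size_initial str_addn /initial /mkseq -map_drop drop_iota add0n.
rewrite subKn// -[X in iota X _]addn0 iotaDl -map_comp.
congr (_ == _); apply: eq_map => i /=; congr x.
by lia.
Qed.

Lemma occ_initial v x n :
  occ v x 0 (n%:Z - 1) = (\sum_(j < n.+1) suffix v (initial x j))%N.
Proof.
rewrite /occ add0r; have [vn|nv] := leqP (size v) n; last first.
  rewrite zrange_nil; last by lia.
  rewrite big1// => j _; rewrite suffix_initial leqNgt.
  by rewrite (leq_trans (ltn_ord j) nv).
have -> : n%:Z - 1 = ((size v)%:Z - 1) + ((n.+1 - size v)%N)%:Z - 1 by lia.
rewrite count_zrange.
have nE : n.+1 = (size v + (n.+1 - size v))%N by lia.
rewrite [in RHS]nE big_split_ord /= [X in (X + _)%N]big1 ?add0n; last first.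
  by move=> j _; rewrite suffix_initial leqNgt /= ltn_ord.
apply: eq_bigr => j _; rewrite suffix_initial leq_addr /=.
by congr nat_of_bool; congr (str _ _ _ == _); lia.
Qed.

Lemma occ_shift v x n (m : int) :
  occ v (time_shift n%:Z x) (- n%:Z) m = occ v x 0 (n%:Z + m).
Proof.
rewrite /occ add0r.
have [k_le|k_gt] := leP (- n%:Z + (size v)%:Z - 1) m; last first.
  by rewrite !zrange_nil//; lia.
have [l mE] := le_addn _ _ k_le.
have nmE : n%:Z + m = ((size v)%:Z - 1) + l%:Z - 1 by lia.
rewrite nmE {1}mE !count_zrange; apply: eq_bigr => j _.
by rewrite str_shift; congr nat_of_bool; congr (str _ _ _ == _); lia.
Qed.

Lemma count_zrange_succ (p : pred int) (m n : int) :
  count p (zrange (m + 1) (n + 1)) = count (fun t => p (t + 1)) (zrange m n).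
Proof.
have [mn|nm] := leP m n; last by rewrite !zrange_nil//; lia.
have [l nE] := le_addn _ _ mn.
have n1E : n + 1 = (m + 1) + l%:Z - 1 by lia.
rewrite n1E nE !count_zrange; apply: eq_bigr => j _.
by congr (nat_of_bool (p _)); lia.
Qed.

End Words.

(** * The test in terms of words *)

Section TestWords.
Context {R : realType} {A : countType}.
Implicit Types (u v s w : seq A) (a b : A) (x : int -> A) (n j : nat).

Definition freq u a s : R := (follows u a s)%:R / (hits u s)%:R.

Lemma freq_ge0 u a s : 0 <= freq u a s.
Proof. by rewrite divr_ge0. Qed.

Lemma freq_le1 u a s : freq u a s <= 1.
Proof.
have [h0|h0] := eqVneq (hits u s) 0%N; first by rewrite /freq h0 invr0 mulr0.
by rewrite ler_pdivrMr ?ltr0n ?lt0n// mul1r ler_nat follows_hits.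
Qed.

Lemma occ_follows u a x n :
  occ (rcons u a) (time_shift n%:Z x) (- n%:Z) 0 = follows u a (initial x n.+1).
Proof.
rewrite occ_shift addr0 (_ : n%:Z = n.+1%:Z - 1); last by lia.
rewrite occ_initial follows_initial big_ord_recl /= suffixs0.
by rewrite -size_eq0 size_rcons add0n.
Qed.

Lemma phat_freq x n a w :
  phat n (time_shift n%:Z x) a w = freq w a (initial x n.+1) :> R.
Proof.
rewrite /phat /freq; congr (_%:R / _%:R).
  rewrite -occ_follows /occ size_rcons.
  set k := (size w)%:Z.
  have -> : zrange (- n%:Z + (size w).+1%:Z - 1) 0 =
      zrange ((- n%:Z + k - 1) + 1) (-1 + 1).
    by congr zrange; rewrite /k; lia.
  rewrite count_zrange_succ; apply: eq_count => t.
  by congr (str _ _ _ == _); rewrite /k; lia.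
rewrite hits_initial -occ_initial.
by rewrite -occ_shift.
Qed.

Section Test.
Variables (gamma beta : R).

Lemma PTEST_yes n x w :
  (forall z a, n%:R `^ (1 - gamma) < (follows (z ++ w) a (initial x n.+1))%:R ->
    `|freq w a (initial x n.+1) - freq (z ++ w) a (initial x n.+1)|
      <= n%:R `^ (- beta)) ->
  PTEST gamma beta n x w.
Proof.
move=> H; rewrite /PTEST /NTEST /Delta_hat.
set S := [set _ | _].
have [S0|/set0P/sup_le_ub] := eqVneq S set0; first by rewrite S0 sup0 powR_ge0.
apply=> _ [z [a [_ + ->]]].
by rewrite /in_L -rcons_cat occ_follows !phat_freq; exact: H.
Qed.

Lemma PTEST_no n x w z a : (0 < size z <= n)%N ->
  n%:R `^ (1 - gamma) < (follows (z ++ w) a (initial x n.+1))%:R ->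
  n%:R `^ (- beta) <
    `|freq w a (initial x n.+1) - freq (z ++ w) a (initial x n.+1)| ->
  ~~ PTEST gamma beta n x w.
Proof.
move=> zn zaL far; rewrite /PTEST /NTEST -ltNge (lt_le_trans far)//.
apply: ub_le_sup.
  exists 1 => _ [z' [a' [_ _ ->]]]; rewrite !phat_freq ler_norml.
  have := freq_ge0 w a' (initial x n.+1); have := freq_le1 w a' (initial x n.+1).
  have := freq_ge0 (z' ++ w) a' (initial x n.+1).
  have := freq_le1 (z' ++ w) a' (initial x n.+1).
  by move=> *; apply/andP; split; lra.
exists z, a; split => //; last by rewrite !phat_freq.
by rewrite /in_L -rcons_cat occ_follows.
Qed.

End Test.
End TestWords.

(** * The path space of a process *)

(** A copy of [int -> A] that carries the sigma-algebra [path_sigma]; the letter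
    [a0] supplies the point that a measurable type must have. *)
Definition paths (A : countType) (a0 : A) : Type := int -> A.

Section PathSpace.
Context {A : countType} (a0 : A).

HB.instance Definition _ := gen_eqMixin (paths A a0).
HB.instance Definition _ := gen_choiceMixin (paths A a0).
HB.instance Definition _ := isPointed.Build (paths A a0) (fun=> a0).

Let gens : set (set (paths A a0)) :=
  [set B | exists n a, B = [set x | x n = a]].

Let path_sigmaC (B : set (paths A a0)) : path_sigma B -> path_sigma (~` B).
Proof. by move=> sB; rewrite -setTD; exact: sigma_algebraCD. Qed.

HB.instance Definition _ := @isMeasurable.Build (sigma_display gens)
  (paths A a0) (@path_sigma A) (@sigma_algebra0 _ setT gens) path_sigmaC
  (@sigma_algebra_bigcup _ setT gens).

Lemma path_measurableE : (measurable : set (set (paths A a0))) = <<s gens >>.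
Proof. by []. Qed.

Lemma measurable_coordinate (n : int) (a : A) :
  measurable ([set x | x n = a] : set (paths A a0)).
Proof. by apply: sub_sigma_algebra; exists n, a. Qed.

Lemma measurable_time_shift (k : int) :
  measurable_fun setT (time_shift k : paths A a0 -> paths A a0).
Proof.
apply: (measurability _ path_measurableE) => _ [_ [n [a ->]] <-].
by rewrite setTI; exact: measurable_coordinate.
Qed.

(** Events determined by finitely many coordinates are countable unions of
    cylinders. *)
Lemma measurable_letters (f : nat -> int) n (Q : set (seq A)) :
  measurable ([set x | Q (mkseq (fun i => x (f i)) n)] : set (paths A a0)).
Proof.
elim: n Q => [|n IH] Q.
  have [Q0|Q0] := pselect (Q [::]).
    by rewrite (_ : [set x | _] = setT)//; apply/seteqP; split.
  by rewrite (_ : [set x | _] = set0)//; apply/seteqP; split.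
rewrite (_ : [set x | _] = \bigcup_(a : A) ([set x | x (f n) = a] `&`
    [set x | [set s | Q (rcons s a)] (mkseq (fun i => x (f i)) n)])); last first.
  apply/seteqP; split => [x /=|x [a _] []/=]; rewrite mkseqS.
    by move=> Qx; exists (x (f n)).
  by move=> ->.
apply: countable_bigcupT_measurable => [|a]; first exact: countableP.
by apply: measurableI; [exact: measurable_coordinate|exact: IH].
Qed.

End PathSpace.

Definition ending {A : countType} (v : seq A) : set (int -> A) :=
  [set x | str x (- (size v)%:Z + 1) 0 = v].

Lemma ending_sigma {A : countType} (v : seq A) : A -> path_sigma (ending v).
Proof.
move=> a0.
have := measurable_letters a0 (fun i => - (size v)%:Z + 1 + i%:Z) (size v) [set v].
rewrite (_ : [set x | _] = ending v)//.
apply/seteqP; split => x; rewrite /ending /= -str_addn;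
  by rewrite (_ : - (size v)%:Z + 1 + (size v)%:Z - 1 = 0)//; lia.
Qed.

(** The event [ending v], seen from time [n], looks into the negative past; it
    agrees with an event of the window as soon as the window is long enough. *)
Lemma ending_initial {A : countType} (v : seq A) (x : int -> A) n :
  (size v <= n.+1)%N -> suffix v (initial x n.+1) <-> ending v (time_shift n%:Z x).
Proof.
move=> vn; rewrite suffix_initial vn /ending /= str_shift.
rewrite (_ : n%:Z + (- (size v)%:Z + 1) = n.+1%:Z - (size v)%:Z); last by lia.
rewrite (_ : n.+1%:Z - 1 = n%:Z + 0); last by lia.
by split => [/eqP|->].
Qed.

(** * Probabilities of words under stationarity *)

Section Process.
Context {d : measure_display} {T : measurableType d} {R : realType}.
Context {A : countType} (P : probability T R) (X : int -> T -> A).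
Hypothesis X_process : is_process X.
Hypothesis X_stationary : stationary P X.
Implicit Types (v u : seq A) (a y : A) (n : nat) (t : T).

Let a0 : A := X 0 point.

Lemma measurable_traj : measurable_fun setT (traj X : T -> paths A a0).
Proof.
apply: (measurability _ (path_measurableE a0)) => _ [_ [n [a ->]] <-].
by rewrite setTI; exact: X_process.
Qed.

Lemma measurable_event (B : set (int -> A)) :
  path_sigma B -> measurable (traj X @^-1` B).
Proof.
by move=> mB; rewrite -[X in measurable X]setTI; exact: measurable_traj.
Qed.

Lemma measurable_initial n (Q : set (seq A)) :
  measurable [set t | Q (initial (traj X t) n)].
Proof. exact: measurable_event (measurable_letters a0 (fun i => i%:Z) n Q). Qed.

Lemma measurable_ending v : measurable (ending_at0 X v).
Proof. exact: measurable_event (ending_sigma v a0). Qed.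

Lemma stationary_iter (B : set (int -> A)) n : path_sigma B ->
  P (traj X @^-1` (time_shift n%:Z @^-1` B)) = P (traj X @^-1` B).
Proof.
move=> mB; elim: n => [|n IH].
  congr (P _); apply/seteqP; split => t /=; rewrite (_ : time_shift 0 _ = traj X t)//;
    by apply/funext => j; rewrite /time_shift add0r.
rewrite -IH -[RHS]X_stationary; last first.
  have := measurable_time_shift a0 n%:Z.
  by move=> /(_ measurableT _ mB); rewrite setTI.
congr (P _); apply/seteqP; split => t /=;
  rewrite (_ : time_shift n.+1 _ = time_shift n (time_shift 1 (traj X t)))//;
  by apply/funext => j; rewrite /time_shift; congr (traj X t _); lia.
Qed.

Lemma suffix_prob v n : (size v <= n)%N ->
  P [set t | suffix v (initial (traj X t) n)] = P (ending_at0 X v).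
Proof.
case: n => [|n] vn.
  rewrite leqn0 size_eq0 in vn; rewrite (eqP vn).
  by congr (P _); apply/seteqP; split.
rewrite -[RHS](stationary_iter _ n (ending_sigma v a0)).
by congr (P _); apply/seteqP; split => t /ending_initial; exact.
Qed.

Lemma prob_fin v : P (ending_at0 X v) = (prob P X v)%:E.
Proof. by rewrite /prob fineK// fin_num_measure//; exact: measurable_ending. Qed.

Lemma prob_ge0 v : 0 <= prob P X v.
Proof. exact: fine_ge0. Qed.

Lemma initial_prob v : 
  P [set t | initial (traj X t) (size v) = v] = (prob P X v)%:E.
Proof.
rewrite -prob_fin -(suffix_prob v _ (leqnn _)); congr (P _).
apply/seteqP; split => t /=; first by move=> {1}<-; exact: suffix_refl.
rewrite suffixE size_initial subnn drop0.
by move=> /eqP.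
Qed.

Lemma cprobE y u : cprob P X y u = prob P X (rcons u y) / prob P X u.
Proof.
rewrite /cprob; congr (fine _ / _).
rewrite -(stationary_iter _ 1 (ending_sigma (rcons u y) a0)).
congr (P _); apply/seteqP.
have stE t : str (time_shift 1 (traj X t)) (- (size (rcons u y))%:Z + 1) 0 =
    rcons (str (traj X t) (- (size u)%:Z + 1) 0) (X 1 t).
  rewrite str_shift size_rcons.
  rewrite (_ : 1 + (- (size u).+1%:Z + 1) = - (size u)%:Z + 1); last by lia.
  rewrite (_ : 1 + 0 = - (size u)%:Z + 1 + (size u).+1%:Z - 1); last by lia.
  rewrite str_addn mkseqS -str_addn; congr rcons.
    by congr str; lia.
  by rewrite /traj; congr X; lia.
split => t; rewrite /ending /ending_at0 /= stE.
  by move=> [-> ->].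
by move=> /rcons_inj[-> ->].
Qed.

End Process.

(** * Frequencies along a trajectory *)

Lemma cvg_average_bounded {R : realType} (u v : nat -> R) (c l : R) :
  (forall n, `|u n - v n| <= c) ->
  u n / n%:R @[n --> \oo] --> l -> v n / n%:R @[n --> \oo] --> l.
Proof.
move=> uv ul.
have d0 : v n / n%:R - u n / n%:R @[n --> \oo] --> (0 : R).
  apply/cvgrPdist_le => /= e e0; near=> n.
  have n0 : 0 < n%:R :> R by rewrite ltr0n; near: n; exact: nbhs_infty_gt.
  have cn : c / e < n%:R by near: n; exact: nbhs_infty_gtr.
  rewrite sub0r normrN -mulrBl normrM normfV (gtr0_norm n0) ler_pdivrMr//.
  by rewrite distrC (le_trans (uv n))// ltW// mulrC -ltr_pdivrMr.
have -> : (fun n => v n / n%:R) =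
    (fun n => (v n / n%:R - u n / n%:R) + u n / n%:R).
  by apply/funext => n; rewrite subrK.
by rewrite -[l]add0r; exact: cvgD.
Unshelve. all: by end_near.
Qed.

Lemma sum_bool_le n (r : nat -> bool) : (\sum_(j < n) r j <= n)%N.
Proof.
rewrite -[leqRHS]card_ord -sum1_card; apply: leq_sum => i _.
by case: (r _).
Qed.

Lemma frequency_eventually_eq {R : realType} (p q : nat -> bool) L (l : R) :
  (forall j, (L <= j)%N -> p j = q j) ->
  (\sum_(j < n) p j)%N%:R / n%:R @[n --> \oo] --> l ->
  (\sum_(j < n) q j)%N%:R / n%:R @[n --> \oo] --> l.
Proof.
move=> pq; apply: (@cvg_average_bounded _ _ _ L%:R) => n.
suff : (\sum_(j < n) p j <= \sum_(j < n) q j + L /\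
        \sum_(j < n) q j <= \sum_(j < n) p j + L)%N.
  rewrite -2!(ler_nat R) !natrD => -[? ?].
  by rewrite ler_norml; apply/andP; split; lra.
have [nL|Ln] := leqP n L.
  by have := sum_bool_le n p; have := sum_bool_le n q; lia.
rewrite -(subnKC (ltnW Ln)) !big_split_ord /=.
have -> : (\sum_(i < n - L) p (L + i) = \sum_(i < n - L) q (L + i))%N.
  by apply: eq_bigr => i _; rewrite pq// leq_addr.
by split; rewrite addnAC leq_add2r (leq_trans (sum_bool_le _ _))// leq_addl.
Qed.

Lemma sum_shift_le {R : realType} (p : nat -> bool) n :
  `|(\sum_(j < n) p j.+1)%N%:R - (\sum_(j < n) p j)%N%:R| <= 1 :> R.
Proof.
have E : (p 0%N + \sum_(j < n) p j.+1 = \sum_(j < n) p j + p n)%N.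
  by rewrite -(big_ord_recl _ (fun j => nat_of_bool (p j))) big_ord_recr.
have /(congr1 (fun k => k%:R : R)) := E; rewrite !natrD => {}E.
have b01 (b : bool) : 0 <= (b%:R : R) <= 1 by case: b; rewrite ?lexx ?ler01.
have := b01 (p 0%N); have /andP[? ?] := b01 (p n) => /andP[? ?].
by rewrite ler_norml; apply/andP; split; lra.
Qed.

Lemma iter_time_shift {A : countType} (x : int -> A) j :
  iter j (time_shift 1) x = time_shift j%:Z x.
Proof.
elim: j => [|j IH] /=; first by apply/funext => k; rewrite /time_shift add0r.
by rewrite IH; apply/funext => k; rewrite /time_shift; congr x; lia.
Qed.

Section Frequency.
Context {d : measure_display} {T : measurableType d} {R : realType}.
Context {A : countType} (P : probability T R) (X : int -> T -> A).
Hypothesis X_process : is_process X.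
Hypothesis X_stationary : stationary P X.
Hypothesis X_ergodic : ergodic P X.

Let a0 : A := X 0 point.

(** The ergodic theorem is applied to the law of the process on the path space,
    where the shift acts. *)
Lemma frequency (B : set (int -> A)) : path_sigma B -> {ae P, forall t,
  (\sum_(j < n) (time_shift j%:Z (traj X t) \in B))%N%:R / n%:R
    @[n --> \oo] --> fine (P (traj X @^-1` B))}.
Proof.
move=> mB.
pose trajectory : {mfun T >-> paths A a0} := HB.pack (traj X)
  (isMeasurableFun.Build _ _ T (paths A a0) (traj X) (measurable_traj X X_process)).
pose law := distribution P trajectory.
have [] := @birkhoff_frequency _ _ _ law
  (time_shift 1) (measurable_time_shift a0 1) _ _ B mB.
- by move=> B' mB'; exact: X_stationary.
- by move=> B' mB'; exact: X_ergodic.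
move=> N [mN N0 NB]; exists (traj X @^-1` N); split => //.
  exact: measurable_event.
move=> t /= tN; apply: NB => /= tB; apply: tN.
have visE n : visits (time_shift 1 : paths A a0 -> paths A a0) B n (traj X t) =
    (\sum_(j < n) (time_shift j%:Z (traj X t) \in B))%N.
  by apply: eq_bigr => j _; rewrite iter_time_shift.
by under eq_fun do rewrite -visE.
Qed.

Lemma word_frequency (v : seq A) : {ae P, forall t,
  (\sum_(j < n) suffix v (initial (traj X t) j))%N%:R / n%:R
    @[n --> \oo] --> prob P X v}.
Proof.
apply: filterS (frequency _ (ending_sigma v a0)) => t freq_t.
apply: (cvg_average_bounded _ _ _ _
  (sum_shift_le (fun j => suffix v (initial (traj X t) j)))).
apply: (@frequency_eventually_eq _
  (fun j => time_shift j%:Z (traj X t) \in ending v)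
  (fun j => suffix v (initial (traj X t) j.+1)) (size v) _ _ freq_t) => j vj.
by apply/idP/idP; rewrite inE => /(ending_initial _ _ _ (leqW vj)).
Qed.

End Frequency.

(** * Discrete random variables *)

Section Discrete.
Context {d : measure_display} {T : measurableType d} {R : realType}.
Context {D : countType} (P : probability T R) (V : T -> D).
Hypothesis measurable_values : forall v, measurable [set t | V t = v].

Let level k : set T := [set t | pickle (V t) = k].

Let level_value k : (exists v, level k = [set t | V t = v]) \/ level k = set0.
Proof.
have [[v vk]|nk] := pselect (exists v : D, pickle v = k); [left|right].
  exists v; apply/seteqP; split => t /=; rewrite /level /= -vk; last by move=> ->.
  exact: (pcan_inj pickleK).
by apply/seteqP; split => // t tk; apply: nk; exists (V t).
Qed.

Let measurable_level k : measurable (level k).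
Proof. by case: (level_value k) => [[v ->]|->]. Qed.

Let trivIset_level : trivIset setT level.
Proof.
by apply/trivIsetP => i j _ _ /eqP ij; apply/seteqP; split => // t [ti tj]; apply: ij; rewrite -ti -tj.
Qed.

Let bigcup_level : \bigcup_k level k = setT.
Proof. by apply/seteqP; split => // t _; exists (pickle (V t)). Qed.

Lemma discrete_measure_le (F G : set T) (c : R) : 0 <= c ->
  measurable F -> measurable G ->
  (forall v, P (F `&` [set t | V t = v]) <= c%:E * P (G `&` [set t | V t = v]))%E ->
  (P F <= c%:E * P G)%E.
Proof.
move=> c0 mF mG FG.
have part E : measurable E -> P E = (\sum_(k <oo) P (E `&` level k))%E.
  move=> mE; rewrite -[in LHS](setIT E) -bigcup_level setI_bigcupr measure_bigcup//.
  - by apply: eq_eseriesl => k; rewrite in_setT.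
  - by move=> k _; exact: measurableI.
  - exact: trivIset_setIl.
rewrite (part _ mF) (part _ mG) -nneseriesZl//.
apply: lee_nneseries => // k _.
case: (level_value k) => [[v ->]|->]; first exact: FG.
by rewrite !setI0 measure0 mule0.
Qed.

(** The bound on each [E v] is proportional to the mass of a value of [V], so the
    masses add up to one and the infinite union costs only the factor [c]. *)
Lemma discrete_union_le (E : D -> set T) (c : R) : 0 <= c ->
  (forall v, measurable (E v)) ->
  (forall v, P (E v) <= c%:E * P [set t | V t = v])%E ->
  (P (\bigcup_v E v) <= c%:E)%E.
Proof.
move=> c0 mE EP.
pose F (k : nat) : set T := if @pickle_inv D k is Some v then E v else set0.
have mF k : measurable (F k) by rewrite /F; case: pickle_inv.
have EF : \bigcup_v E v `<=` \bigcup_k F k.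
  by move=> t [v _ vt]; exists (pickle v) => //; rewrite /F pickleK_inv.
have mUE : measurable (\bigcup_v E v).
  by apply: countable_bigcupT_measurable => //; exact: countableP.
apply: (@le_trans _ _ (\sum_(k <oo) P (F k))%E).
  exact: measure_sigma_subadditive mF mUE EF.
have P1 : (\sum_(k <oo) P (level k))%E = 1%E.
  rewrite -(probability_setT P) -bigcup_level measure_bigcup//.
  by apply: eq_eseriesl => k; rewrite in_setT.
rewrite -[leRHS]mule1 -P1 -nneseriesZl//.
apply: lee_nneseries => // k _; rewrite /F.
case E' : (@pickle_inv D k) => [v|]; last by rewrite measure0 mule_ge0// lee_fin.
apply: le_trans (EP v) _; rewrite lee_wpmul2l ?lee_fin// le_measure ?inE//.
move=> t /= Vt; rewrite /level /= Vt.
by have := @pickle_invK D k; rewrite E'.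
Qed.

Lemma discrete_integral_le (f g : T -> \bar R) :
  measurable_fun setT f -> measurable_fun setT g ->
  (forall t, 0 <= f t)%E -> (forall t, 0 <= g t)%E ->
  (forall v, \int[P]_(t in [set t | V t = v]) f t
      <= \int[P]_(t in [set t | V t = v]) g t)%E ->
  (\int[P]_t f t <= \int[P]_t g t)%E.
Proof.
move=> mf mg f0 g0 fg; rewrite -bigcup_level !ge0_integral_bigcup//; last 2 first.
- by rewrite bigcup_level.
- by rewrite bigcup_level.
apply: lee_nneseries => [k _ _|k _]; first exact: integral_ge0.
case: (level_value k) => [[v ->]|->]; first exact: fg.
by rewrite !integral_set0.
Qed.

End Discrete.

(** * The letter that follows a memory word *)

(** A quadratic correction reverses the inequality [1 + y <= expR y] near [0]; for
    negative [y] the correction [y ^+ 2] would be too small. *)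
Lemma expR_le1D {R : realType} (y : R) : `|y| <= 2^-1 -> expR (y - 2 * y ^+ 2) <= 1 + y.
Proof.
rewrite ler_norml => /andP[y1 y2].
have h : 0 < 1 - y + 2 * y ^+ 2 by nra.
rewrite -[expR _]invrK -expRN.
have : 1 - y + 2 * y ^+ 2 <= expR (- (y - 2 * y ^+ 2)).
  by apply: le_trans (expR_ge1Dx _); lra.
rewrite -lef_pV2 ?posrE ?expR_gt0// => /le_trans; apply.
by rewrite invf_ple ?posrE; first rewrite -div1r ler_pdivrMr; nra.
Qed.

Section Memory.
Context {d : measure_display} {T : measurableType d} {R : realType}.
Context {A : countType} (P : probability T R) (X : int -> T -> A).
Hypothesis X_process : is_process X.
Hypothesis X_stationary : stationary P X.
Implicit Types (v u z s : seq A) (a b y : A) (n : nat) (t : T).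

Notation W n t := (initial (traj X t) n).
Notation p v := (prob P X v).

Definition memory_word u : Prop := forall z y, (1 <= size z)%N ->
  0 < p (z ++ rcons u y) -> cprob P X y u = cprob P X y (z ++ u).

Lemma probability_setD (E F : set T) : measurable E -> measurable F ->
  P (E `\` F) = (P E - P (E `&` F))%E.
Proof. by move=> mE mF; apply: measureD => //; rewrite ltey_eq fin_num_measure. Qed.

Lemma suffix_probE v n : (size v <= n)%N ->
  P [set t | suffix v (W n t)] = (p v)%:E.
Proof. by move=> vn; rewrite (suffix_prob P X X_stationary)// (prob_fin P X X_process). Qed.

Lemma suffix_letter_prob v a n : (size v <= n)%N ->
  P ([set t | suffix v (W n t)] `&` [set t | X n%:Z t = a]) = (p (rcons v a))%:E.
Proof.
move=> vn; rewrite -(suffix_probE _ n.+1) ?size_rcons//; congr (P _).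
apply/seteqP; split => t /=; rewrite initialS suffix_rcons.
  by move=> [-> <-]; rewrite eqxx.
by move=> /andP[/eqP -> ->].
Qed.

Lemma suffix_event n v : measurable [set t | suffix v (W n t)].
Proof. exact: measurable_initial X X_process n [set s | suffix v s]. Qed.

Lemma prob_rcons v a : p (rcons v a) <= p v.
Proof.
rewrite -lee_fin -(suffix_letter_prob _ _ _ (leqnn _)).
rewrite -(suffix_probE _ _ (leqnn _)) le_measure ?inE//.
- by apply: measurableI; [exact: suffix_event|exact: X_process].
- exact: suffix_event.
Qed.

Lemma prob_cat z v : p (z ++ v) <= p v.
Proof.
have vz : (size v <= size (z ++ v))%N by rewrite size_cat leq_addl.
rewrite -lee_fin -(suffix_probE _ _ vz) -(suffix_probE _ _ (leqnn _)).
rewrite le_measure ?inE//; try exact: suffix_event.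
by move=> t /=; apply: suffix_trans; exact: suffix_suffix.
Qed.

(** Memory only constrains the letters that can follow [z ++ u].  They already
    exhaust the conditional law given [u], so the law given [u] puts no mass on
    the others. *)
Lemma memory_word_next u z a : memory_word u ->
  p (rcons (z ++ u) a) = cprob P X a u * p (z ++ u).
Proof.
move=> mem_u; set v := z ++ u.
have [pv0|pv_neq0] := eqVneq (p v) 0.
  by apply/eqP; rewrite pv0 mulr0 eq_le -{1}pv0 prob_rcons prob_ge0.
have pv : 0 < p v by rewrite lt_neqAle eq_sym pv_neq0 prob_ge0.
have pu : 0 < p u by rewrite (lt_le_trans pv)// prob_cat.
have transfer b : 0 < p (rcons v b) -> p (rcons u b) / p u = p (rcons v b) / p v.
  move=> pb; rewrite -!(cprobE P X X_stationary).
  have [z0|z_gt0] := posnP (size z); first by rewrite /v (size0nil z0).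
  by apply: mem_u; rewrite // -rcons_cat.
rewrite (cprobE P X X_stationary); have [/transfer ->|] := ltP 0 (p (rcons v a)); first by rewrite divfK.
move=> pa0; have {pa0} pa : p (rcons v a) = 0 by apply/eqP; rewrite eq_le pa0 prob_ge0.
rewrite pa; suff -> : p (rcons u a) = 0 by rewrite !mul0r.
apply/eqP; rewrite eq_le prob_ge0// andbT.
set n := size v.
have un : (size u <= n)%N by rewrite /n size_cat leq_addl.
pose Eu := [set t | suffix u (W n t)].
pose F := Eu `\` [set t | X n%:Z t = a].
have mXa b : measurable [set t | X n%:Z t = b] by exact: X_process.
have mF : measurable F.
  by apply: measurableD; first exact: suffix_event.
have PEu : P Eu = (p u)%:E by exact: suffix_probE.
have PF : P F = (p u - p (rcons u a))%:E.
  by rewrite probability_setD ?PEu ?suffix_letter_prob//; exact: suffix_event.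
have : (P [set t | suffix v (W n t)] <= (p v / p u)%:E * P F)%E.
  apply: (discrete_measure_le P (X n%:Z)) => //; first by rewrite divr_ge0// ltW.
    exact: suffix_event.
  move=> b; rewrite suffix_letter_prob//.
  have [pb|pb] := ltP 0 (p (rcons v b)); last first.
    rewrite (@le_trans _ _ 0%E) ?lee_fin// mule_ge0// lee_fin.
    by rewrite divr_ge0// ltW.
  rewrite (_ : F `&` _ = Eu `&` [set t | X n%:Z t = b]); last first.
    apply/seteqP; split => [t [[? ?] ?]//|t [? /= tb]].
    by split => //; split => //= ta; move: pb; rewrite -tb ta pa ltxx.
  rewrite suffix_letter_prob// -EFinM lee_fin mulrAC -mulrA transfer//.
  by rewrite mulrC divfK.
rewrite suffix_probE// PF -EFinM lee_fin -[leLHS]mulr1 -mulrA ler_pM2l//.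
rewrite mulrC ler_pdivlMr//; lra.
Qed.

Lemma measurable_word_fun (f : seq A -> R) n :
  measurable_fun setT (fun t => (f (W n t))%:E).
Proof.
apply/measurable_EFinP => _ Y _; rewrite setTI.
exact: measurable_initial X X_process n (f @^-1` Y).
Qed.

Definition expect n (f : seq A -> R) : \bar R := (\int[P]_t (f (W n t))%:E)%E.

(** One step of a supermartingale: [h] bounds the value of [f] when the next
    letter is not [a], and the inequality compares the conditional expectation of
    [f] given the word [v] with [g v]. *)
Lemma expect_step (f g h : seq A -> R) n a :
  (forall v, 0 <= f v) -> (forall v, 0 <= g v) -> (forall v, 0 <= h v) ->
  (forall v b, b != a -> f (rcons v b) <= h v) ->
  (forall v, f (rcons v a) * p (rcons v a) + h v * (p v - p (rcons v a))
     <= g v * p v) ->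
  (expect n.+1 f <= expect n g)%E.
Proof.
move=> f0 g0 h0 fh fg.
apply: (discrete_integral_le P (fun t => W n t)) => //.
- by move=> v; exact: (measurable_initial X X_process n [set v]).
- exact: measurable_word_fun.
- exact: measurable_word_fun.
- by move=> t; rewrite lee_fin.
- by move=> t; rewrite lee_fin.
move=> v; have [vn|nvn] := eqVneq (size v) n; last first.
  rewrite (_ : [set t | _] = set0) ?integral_set0//.
  apply/seteqP; split => // t /= tv.
  by move: nvn; rewrite -tv size_initial eqxx.
set E := [set t | _].
have PE : P E = (p v)%:E by rewrite /E -vn initial_prob.
pose Ea := E `&` [set t | X n%:Z t = a].
pose Eb := E `\` [set t | X n%:Z t = a].
have mE : measurable E by exact: (measurable_initial X X_process n [set v]).
have mXa : measurable [set t | X n%:Z t = a] by exact: X_process.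
have mEa : measurable Ea by exact: measurableI.
have mEb : measurable Eb by exact: measurableD.
have PEa : P Ea = (p (rcons v a))%:E.
  rewrite /Ea /E -vn -(initial_prob P X X_process X_stationary); congr (P _).
  apply/seteqP; split => t /=; rewrite size_rcons initialS.
    by move=> [-> <-].
  by move=> /rcons_inj[-> <-].
have PEb : P Eb = (p v - p (rcons v a))%:E.
  by rewrite probability_setD// PE PEa.
have -> : E = Ea `|` Eb by rewrite /Eb setDE -setIUr setUCr setIT.
rewrite [leLHS]ge0_integral_setU//; last 3 first.
- by apply: measurable_funTS; exact: measurable_word_fun.
- by move=> t _; rewrite lee_fin.
- by apply/eqP; rewrite /Ea /Eb setDE setIACA setICr setI0.
have bound E' (c : R) : 0 <= c -> measurable E' ->
    (forall t, E' t -> f (W n.+1 t) <= c) ->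
    (\int[P]_(t in E') (f (W n.+1 t))%:E <= c%:E * P E')%E.
  move=> c0 mE' fc; rewrite -integral_cst//; apply: ge0_le_integral => //.
  - by move=> t _; rewrite lee_fin.
  - by apply: measurable_funTS; exact: measurable_word_fun.
have Ia : (\int[P]_(t in Ea) (f (W n.+1 t))%:E <= (f (rcons v a))%:E * P Ea)%E.
  by apply: bound => // t [/= Et ta]; rewrite initialS Et -ta.
have Ib : (\int[P]_(t in Eb) (f (W n.+1 t))%:E <= (h v)%:E * P Eb)%E.
  by apply: bound => // t [/= Et /eqP ta]; rewrite initialS Et fh.
apply: le_trans (leeD Ia Ib) _; rewrite PEa PEb -!EFinM -EFinD.
rewrite (@le_trans _ _ (g v * p v)%:E) ?lee_fin//.
rewrite EFinM -PE -integral_cst// /Eb setDE -setIUr setUCr setIT.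
by rewrite le_eqVlt (eq_integral (fun t => (g (W n t))%:E)) ?eqxx// => t /set_mem <-.
Qed.


Lemma expect_le n (f g : seq A -> R) :
  (forall s, 0 <= f s) -> (forall s, f s <= g s) -> (expect n f <= expect n g)%E.
Proof.
move=> f0 fg; apply: ge0_le_integral => //; last 2 first.
- exact: measurable_word_fun.
- by move=> t _; rewrite lee_fin.
- by move=> t _; rewrite lee_fin.
- exact: measurable_word_fun.
Qed.

Lemma expectD n (f g : seq A -> R) :
  (forall s, 0 <= f s) -> (forall s, 0 <= g s) ->
  expect n (fun s => f s + g s) = (expect n f + expect n g)%E.
Proof.
move=> f0 g0; rewrite /expect -ge0_integralD//.
- by move=> t _; rewrite lee_fin.
- exact: measurable_word_fun.
- by move=> t _; rewrite lee_fin.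
- exact: measurable_word_fun.
Qed.

Lemma expectZl n (c : R) (f : seq A -> R) : 0 <= c -> (forall s, 0 <= f s) ->
  expect n (fun s => c * f s) = (c%:E * expect n f)%E.
Proof.
move=> c0 f0; rewrite /expect -ge0_integralZl//.
- exact: measurable_word_fun.
- by move=> t _; rewrite lee_fin.
Qed.

Lemma expect_indicator n (Q : pred (seq A)) :
  expect n (fun s => (Q s)%:R) = P [set t | Q (W n t)].
Proof.
rewrite -[[set t | _]]setIT -integral_indic//; last first.
  exact: measurable_initial X X_process n Q.
apply: eq_integral => t _; rewrite indicE; congr (_%:R%:E); congr nat_of_bool.
by apply/idP/idP => [Qt|/set_mem//]; exact: mem_set.
Qed.

Lemma expect0 (f : seq A -> R) : expect 0 f = (f [::])%:E.
Proof.
rewrite /expect /initial /mkseq /= integral_cst//.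
by rewrite [X in (_ * X)%E]probability_setT mule1.
Qed.

Lemma prob_infix u n :
  (P [set t | infix u (W n t)] <= (n.+1%:R * p u)%:E)%E.
Proof.
have suffix_le m : (P [set t | suffix u (W m t)] <= (p u)%:E)%E.
  have [um|mu] := leqP (size u) m; first by rewrite suffix_probE.
  rewrite (_ : [set t | _] = set0) ?measure0 ?lee_fin ?prob_ge0//.
  apply/seteqP; split => // t /= /size_suffix.
  by rewrite size_initial leqNgt mu.
elim: n => [|n IH].
  rewrite mul1r (_ : [set t | _] = [set t | suffix u (W 0 t)])//.
  have W0 t : W 0 t = [::] by [].
  by apply/funext => t; rewrite /mkset W0 infixs0 suffixs0.
rewrite -[n.+2%:R]natr1 mulrDl mul1r addrC EFinD.
apply: le_trans (leeD (suffix_le n.+1) IH).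
rewrite (_ : [set t | _] =
    [set t | suffix u (W n.+1 t)] `|` [set t | infix u (W n t)]).
  apply: measureU2; first exact: suffix_event.
  exact: measurable_initial X X_process n (infix u).
by apply/seteqP; split => t; rewrite /setU /mkset initialS infix_rconsl => /orP.
Qed.

(** * Exponential deviation bound *)

Definition deviant (q delta m : R) u a s : bool :=
  [&& infix (rcons u a) s, m <= (hits u s)%:R
    & delta * (hits u s)%:R <= `|(follows u a s)%:R - q * (hits u s)%:R| ].

Section Deviation.
Variables (u : seq A) (a : A) (q : R).
Hypothesis q_itv : 0 <= q <= 1.
Hypothesis next_law : forall v, suffix u v -> p (rcons v a) = q * p v.

(** The correction [2 * l ^+ 2] per trial makes the exponential of the centred
    count a supermartingale for [l] small, of either sign. *)
Definition weight (l : R) v : R := expR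
  (l * ((follows u a v)%:R - q * (hits u v)%:R) - 2 * l ^+ 2 * (hits u v)%:R).

Section Rate.
Variable l : R.
Hypothesis l_small : `|l| <= 2^-1.

Lemma weight_ge0 v : 0 <= weight l v. Proof. exact: expR_ge0. Qed.

Lemma weight_rcons v b : weight l (rcons v b) = weight l v *
  (if suffix u v then expR (l * ((a == b)%:R - q) - 2 * l ^+ 2) else 1).
Proof.
rewrite /weight follows_rcons hits_rcons.
case: (suffix u v) => /=; last by rewrite !addn0 mulr1.
by rewrite -expRD !natrD; congr expR; ring.
Qed.

Lemma weight_rcons_le v b : weight l (rcons v b) <=
  weight l v * (if suffix u v then 1 + l * ((a == b)%:R - q) else 1).
Proof.
rewrite weight_rcons; case: ifP => // _.
rewrite ler_wpM2l ?weight_ge0//.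
have /andP[q0 q1] := q_itv.
have c1 : `|(a == b)%:R - q| <= 1.
  by rewrite ler_norml; case: (a == b) => /=; apply/andP; split; lra.
set c := _ - q in c1 *.
have lc : `|l * c| <= 2^-1.
  by rewrite normrM -[2^-1]mulr1 ler_pM.
apply: le_trans (expR_le1D _ lc); rewrite ler_expR lerD2l lerN2 ler_pM2l//.
rewrite exprMn ler_piMr ?sqr_ge0//.
by rewrite -real_normK ?num_real// expr_le1.
Qed.

Let after_other v : R := if suffix u v then 1 - l * q else 1.

Let after_other_ge0 v : 0 <= after_other v.
Proof.
rewrite /after_other; case: ifP => // _; move: l_small q_itv.
by rewrite ler_norml => /andP[? ?] /andP[? ?]; nra.
Qed.

Let weight_other v b : b != a -> weight l (rcons v b) <= weight l v * after_other v.
Proof.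
move=> ba; apply: le_trans (weight_rcons_le v b) _.
by rewrite /after_other eq_sym (negbTE ba) sub0r mulrN.
Qed.

Let weight_balance v :
  weight l (rcons v a) * p (rcons v a) +
    weight l v * after_other v * (p v - p (rcons v a)) <= weight l v * p v.
Proof.
have := weight_rcons_le v a; rewrite eqxx mulr1n /after_other.
have := weight_ge0 v; have := prob_ge0 P X v; have /andP[q0 q1] := q_itv.
case: ifP => [uv|uv]; last first.
  by rewrite !mulr1 => _ _ /(ler_wpM2r (prob_ge0 P X (rcons v a))); lra.
rewrite (next_law _ uv) => pv wv w_le.
have qp : 0 <= q * p v by rewrite mulr_ge0.
apply: le_trans (lerD (ler_wpM2r qp w_le) (lexx _)) _.
by rewrite le_eqVlt; apply/orP; left; apply/eqP; ring.
Qed.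

Lemma expect_weight n : (expect n (weight l) <= 1)%E.
Proof.
elim: n => [|n IH].
  rewrite expect0 /weight /follows /hits !big_ord0 mulr0 subrr mulr0 mulr0 subrr.
  by rewrite expR0.
apply: le_trans IH.
apply: (expect_step _ _ (fun v => weight l v * after_other v) n a) => //.
- exact: weight_ge0.
- exact: weight_ge0.
- by move=> v; rewrite mulr_ge0 ?weight_ge0.
Qed.

(** The weight equals [1] as long as [u] has not occurred, so that part of the
    total expectation is the probability that [u] does not occur; as the total is
    at most [1], the rest is at most the probability that [u] occurs. *)
Lemma expect_weight_infix n :
  (expect n (fun s => (weight l s * (infix u s)%:R)%R) <= (n.+1%:R * p u)%:E)%E.
Proof.
apply: le_trans (prob_infix u n).
rewrite -(expect_indicator n (infix u)).
have fin : expect n (fun s => (~~ infix u s)%:R) \is a fin_num.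
  rewrite (expect_indicator n (fun s => ~~ infix u s)) fin_num_measure//.
  exact: measurable_initial X X_process n (fun s => ~~ infix u s).
rewrite -(leeD2rE _ _ fin) -!expectD//; last first.
  by move=> s; rewrite mulr_ge0 ?weight_ge0.
apply: (@le_trans _ _ 1%E); last first.
  have -> : (fun s : seq A => (infix u s)%:R + (~~ infix u s)%:R) = (fun=> 1 : R).
    by apply/funext => s; case: infix; rewrite /= ?addr0 ?add0r.
  by rewrite /expect integral_cst// [X in (_ * X)%E]probability_setT mule1.
apply: le_trans (expect_weight n); apply: expect_le => s.
  by rewrite addr_ge0// mulr_ge0 ?weight_ge0.
have [us|us] := boolP (infix u s); first by rewrite mulr1 addr0.
rewrite mulr0 add0r /weight hits_infix//.
have -> : follows u a s = 0%N.
  by apply/eqP; rewrite -leqn0 -(hits_infix _ _ us) follows_hits.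
by rewrite !mulr0 !subr0 mulr0 expR0.
Qed.

(** At its first occurrence, [u a] takes at most a share [2 * q] of the weight
    carried by the occurrences of [u]: this gains the factor [q] that makes the
    bound summable over the letters [a]. *)
Lemma expect_weight_follows n :
  (expect n (fun s => (weight l s * (infix (rcons u a) s)%:R)%R)
     <= (2 * n.+1%:R ^+ 2 * p (rcons u a))%:E)%E.
Proof.
have pua : p (rcons u a) = q * p u by rewrite next_law// suffix_refl.
have /andP[q0 q1] := q_itv.
elim: n => [|n IH].
  rewrite expect0 infixs0 -size_eq0 size_rcons mulr0 lee_fin.
  by rewrite mulr_ge0// ?mulr_ge0// prob_ge0.
pose g s := weight l s * (infix (rcons u a) s)%:R + 2 * q * (weight l s * (infix u s)%:R).
apply: (@le_trans _ _ (expect n g)).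
  apply: (expect_step _ _
    (fun v => weight l v * (infix (rcons u a) v)%:R * after_other v) n a).
  - by move=> v; rewrite mulr_ge0 ?weight_ge0.
  - by move=> v; rewrite addr_ge0// ?mulr_ge0 ?weight_ge0.
  - by move=> v; rewrite mulr_ge0// mulr_ge0 ?weight_ge0.
  - move=> v b ba; rewrite infix_rconsl suffix_rcons eq_sym (negbTE ba) /=.
    by rewrite mulrAC ler_wpM2r// weight_other.
  move=> v; rewrite infix_rconsl suffix_rcons eqxx /= /g mulrDl.
  have [uav|uav] := boolP (infix (rcons u a) v).
    rewrite orbT !mulr1 (le_trans (weight_balance v))// lerDl.
    by rewrite mulr_ge0 ?prob_ge0// !mulr_ge0 ?weight_ge0.
  rewrite orbF !mulr0 !mul0r addr0 add0r.
  have [uv|uv] := boolP (suffix u v); last first.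
    by rewrite mulr0 mul0r mulr_ge0 ?prob_ge0// !mulr_ge0 ?weight_ge0.
  rewrite (suffixW uv) !mulr1 next_law//.
  have -> : 2 * q * weight l v * p v = 2 * weight l v * (q * p v) by ring.
  rewrite ler_wpM2r ?mulr_ge0 ?prob_ge0//.
  apply: le_trans (weight_rcons_le v a) _; rewrite uv eqxx mulr1n mulrC.
  rewrite ler_wpM2r ?weight_ge0//.
  by move: l_small; rewrite ler_norml => /andP[? ?]; nra.
rewrite expectD//; last 2 first.
- by move=> s; rewrite mulr_ge0 ?weight_ge0.
- by move=> s; rewrite !mulr_ge0 ?weight_ge0.
rewrite expectZl ?mulr_ge0//; last by move=> s; rewrite mulr_ge0 ?weight_ge0.
have q2 : (0 <= (2 * q)%:E)%E by rewrite lee_fin mulr_ge0.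
apply: le_trans (leeD IH (lee_wpmul2l q2 (expect_weight_infix n))) _.
rewrite -EFinM -EFinD lee_fin pua -[n.+2%:R]natr1.
rewrite -subr_ge0; set m := n.+1%:R.
have -> : 2 * (m + 1) ^+ 2 * (q * p u) -
    (2 * m ^+ 2 * (q * p u) + 2 * q * (m * p u)) = 2 * (q * p u) * (m + 1) by ring.
by rewrite !mulr_ge0 ?prob_ge0 ?addr_ge0.
Qed.

End Rate.

Lemma deviation_prob (delta m : R) n : 0 <= delta <= 1 ->
  (P [set t | deviant q delta m u a (W n t)]
   <= (4 * n.+1%:R ^+ 2 * expR (- (delta ^+ 2 * m / 8)) * p (rcons u a))%:E)%E.
Proof.
move=> /andP[d0 d1].
set c := delta ^+ 2 * m / 8.
pose heavy l : set T := [set t | infix (rcons u a) (W n t) && (expR c <= weight l (W n t))].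
have heavy_prob l : `|l| <= 2^-1 ->
    (P (heavy l) <= (2 * n.+1%:R ^+ 2 * expR (- c) * p (rcons u a))%:E)%E.
  move=> l_small.
  have : ((expR c)%:E * P (heavy l) <=
      (2 * n.+1%:R ^+ 2 * p (rcons u a))%:E)%E.
    apply: le_trans (expect_weight_follows _ l_small n).
    rewrite -(expect_indicator n
      (fun s => infix (rcons u a) s && (expR c <= weight l s))).
    rewrite -expectZl ?expR_ge0//; apply: expect_le => s; first by rewrite mulr_ge0 ?expR_ge0.
    case: infix; rewrite ?mulr0// mulr1 /=.
    by have [cw|_] := leP (expR c) (weight l s); rewrite ?mulr1 ?mulr0 ?weight_ge0.
  rewrite muleC -lee_pdivlMr ?expR_gt0// => /le_trans; apply.
  rewrite -EFinM lee_fin expRN le_eqVlt; apply/orP; left; apply/eqP; ring.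
have mheavy l : measurable (heavy l).
  exact: measurable_initial X X_process n
    (fun s => infix (rcons u a) s && (expR c <= weight l s)).
have l1 : `|delta / 4| <= 2^-1 by rewrite ger0_norm; lra.
have l2 : `|- (delta / 4)| <= 2^-1 by rewrite normrN.
apply: (@le_trans _ _ (P (heavy (delta / 4) `|` heavy (- (delta / 4))))).
  rewrite le_measure ?inE//.
  - exact: measurable_initial X X_process n (deviant q delta m u a).
  - exact: measurableU.
  move=> t /and3P[uat]; rewrite /heavy /setU /mkset uat !ler_expR /c.
  set N := (hits u _)%:R; set Z := _ - q * N => mN.
  (* delta / 4 maximizes l * delta - 2 * l ^+ 2, with maximum delta ^+ 2 / 8 *)
  have d2m : delta ^+ 2 * m <= delta ^+ 2 * N by rewrite ler_wpM2l ?sqr_ge0.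
  by rewrite ler_normr => /orP[/(ler_wpM2l d0)|/(ler_wpM2l d0)] dZ; [left|right];
    rewrite /= ?sqrrN; nra.
apply: le_trans (measureU2 _ _ _) _ => //.
apply: le_trans (leeD (heavy_prob _ l1) (heavy_prob _ l2)) _.
by rewrite -EFinD lee_fin le_eqVlt; apply/orP; left; apply/eqP; ring.
Qed.

End Deviation.

End Memory.

(** * Memory words pass the test *)

Section Summable.
Context {R : realType}.

Lemma nneseries_telescope (f : nat -> \bar R) (K : R) : (forall n, 0 <= f n)%E ->
  (forall n, f n <= (K / (n.+1%:R * n.+2%:R))%:E)%E ->
  (\sum_(n <oo) f n < +oo)%E.
Proof.
move=> f0 fK; apply: (@le_lt_trans _ _ K%:E); last exact: ltry.
have K0 : 0 <= K.
  have := le_trans (f0 0%N) (fK 0%N); rewrite lee_fin mul1r.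
  by rewrite pmulr_lge0// invr_gt0.
apply: lime_le; first exact: is_cvg_nneseries.
apply: nearW => N; apply: (@le_trans _ _ (K * (1 - N.+1%:R^-1))%:E); last first.
  by rewrite lee_fin ler_piMr// gerBl.
elim: N => [|N IH]; first by rewrite big_nil invr1 subrr mulr0.
rewrite big_nat_recr//=; apply: le_trans (leeD IH (fK N)) _.
rewrite -EFinD lee_fin le_eqVlt; apply/orP; left; apply/eqP.
have n1 : N.+1%:R != 0 :> R by rewrite pnatr_eq0.
have n2 : N.+2%:R != 0 :> R by rewrite pnatr_eq0.
have n12 : N.+2%:R = N.+1%:R + 1 :> R by rewrite natr1.
move: n1 n2; rewrite n12; move: N.+1%:R => x x0 x1.
by field; rewrite x0 x1.
Qed.

(** A single term of the exponential series suffices: its order is chosen so that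
    it beats the five powers of [n] on the two sides. *)
Lemma expR_power_decay (c b : R) : 0 < c -> 0 < b -> exists K : R,
  forall n, 4 * n.+2%:R ^+ 3 * expR (- (n%:R `^ c / b)) <= K / (n.+1%:R * n.+2%:R).
Proof.
move=> c0 b0; set k := Num.bound (5 / c).
have kc : 5 <= c * k.+1%:R.
  rewrite -ler_pdivrMl// mulrC.
  have : 5 / c < k%:R by apply: archi_boundP; rewrite divr_ge0// ltW.
  by rewrite -natr1; lra.
pose D : R := k.+1`!%:R * b ^+ k.+1.
have D0 : 0 < D by rewrite mulr_gt0 ?exprn_gt0// ltr0n fact_gt0.
exists (64 + 648 * D) => n; rewrite ler_pdivlMr; last by rewrite mulr_gt0.
have [->|n_gt0] := posnP n.
  have : expR (- (0%:R `^ c / b)) <= 1.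
    by rewrite -expR0 ler_expR oppr_le0 divr_ge0 ?powR_ge0// ltW.
  move=> e1; have := expR_ge0 (- (0%:R `^ c / b)); nra.
have n1 : 1 <= n%:R :> R by rewrite ler1n.
set x := n%:R `^ c / b.
have x0 : 0 <= x by rewrite divr_ge0 ?powR_ge0// ltW.
have decay : expR (- x) * n%:R ^+ 5 <= D.
  rewrite expRN mulrC ler_pdivrMr ?expR_gt0//.
  have := expR_ge1Dxn k x0 => ex.
  have xk : n%:R ^+ 5 <= x ^+ k.+1 * b ^+ k.+1.
    rewrite -exprMn /x divfK ?gt_eqF// -!powR_mulrn ?powR_ge0// -powRrM.
    by rewrite ler_powR.
  have -> : D * expR x = (k.+1`!%:R * expR x) * b ^+ k.+1 by rewrite /D; ring.
  apply: (le_trans xk); apply: ler_wpM2r; first by rewrite exprn_ge0// ltW.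
  rewrite mulrC -ler_pdivrMr ?ltr0n ?fact_gt0//; lra.
have n2 : n.+2%:R <= 3 * n%:R :> R by rewrite -[n.+2]addn2 natrD; lra.
have n1' : n.+1%:R <= 2 * n%:R :> R by rewrite -natr1; lra.
have e0 := expR_ge0 (- x).
have : n.+2%:R ^+ 3 * (n.+1%:R * n.+2%:R) <= (3 * n%:R) ^+ 3 * (2 * n%:R * (3 * n%:R)) :> R.
  by rewrite ler_pM ?mulr_ge0 ?exprn_ge0 ?lerXn2r ?nnegrE ?mulr_ge0 ?ler_pM.
move=> /(ler_wpM2l e0); rewrite -/x.
have -> : expR (- x) * ((3 * n%:R) ^+ 3 * (2 * n%:R * (3 * n%:R))) =
  162 * (expR (- x) * n%:R ^+ 5) by ring.
have -> : 4 * n.+2%:R ^+ 3 * expR (- x) * (n.+1%:R * n.+2%:R) =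
  4 * (expR (- x) * (n.+2%:R ^+ 3 * (n.+1%:R * n.+2%:R))) by ring.
lra.
Qed.

End Summable.

Section MemoryTest.
Context {d : measure_display} {T : measurableType d} {R : realType}.
Context {A : countType} (P : probability T R) (X : int -> T -> A).
Hypothesis X_process : is_process X.
Hypothesis X_stationary : stationary P X.
Variables (gamma beta : R).
Hypothesis beta_itv : 0 < beta < (1 - gamma) / 2.
Implicit Types (v u z s : seq A) (a b y : A) (n : nat) (t : T).
Variable w : seq A.
Hypothesis w_memory : memory_word P X w.

Notation W n t := (initial (traj X t) n).
Notation p v := (prob P X v).
Notation q a := (cprob P X a w).

Let cprob_itv a : 0 <= q a <= 1.
Proof.
rewrite cprobE// divr_ge0 ?prob_ge0//=.
have [->|pw] := eqVneq (p w) 0; first by rewrite invr0 mulr0.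
by rewrite ler_pdivrMr ?mul1r ?prob_rcons// lt_neqAle eq_sym pw prob_ge0.
Qed.

Let next_law u a : suffix w u -> forall v, suffix u v ->
  p (rcons v a) = q a * p v.
Proof.
move=> wu v /(suffix_trans wu)/suffixP[z ->].
exact: memory_word_next.
Qed.

Let delta n : R := n%:R `^ (- beta) / 2.
Let m n : R := n%:R `^ (1 - gamma).

Definition test_deviant n s : Prop := exists u a,
  suffix w u /\ deviant (q a) (delta n) (m n) u a s.

(** Both empirical laws that the test compares estimate the same law, so a
    difference above [n ^ (- beta)] forces one of them to be off by half of it. *)
Lemma test_fails_deviant n x : ~~ PTEST gamma beta n x w ->
  test_deviant n (initial x n.+1).
Proof.
set s := initial x n.+1 => test_no; apply: contrapT => /forallNP no_dev.
move: test_no => /negP; apply; apply: PTEST_yes => z a; rewrite -/s => m_lt.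
have mz : 0 < (follows (z ++ w) a s)%:R :> R by rewrite (le_lt_trans _ m_lt)// powR_ge0.
have wzw : suffix w (z ++ w) by exact: suffix_suffix.
have dev u : suffix w u -> suffix u (z ++ w) -> `|freq u a s - q a| <= delta n.
  move=> wu uzw; rewrite leNgt; apply/negP => far.
  have fu : (follows (z ++ w) a s <= follows u a s)%N by exact: follows_suffix.
  have mh : m n <= (hits u s)%:R.
    by rewrite (le_trans (ltW m_lt))// ler_nat (leq_trans fu)// follows_hits.
  apply: (no_dev u); exists a; split => //; apply/and3P; split => //.
    by apply: follows_infix; rewrite (leq_trans _ fu)// -(ltr0n R).
  have h0 : 0 < (hits u s)%:R :> R.
    by rewrite (lt_le_trans mz)// ler_nat (leq_trans fu)// follows_hits.
  have -> : (follows u a s)%:R - q a * (hits u s)%:R = (freq u a s - q a) * (hits u s)%:R.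
    by rewrite mulrBl /freq divfK// gt_eqF.
  by rewrite normrM (gtr0_norm h0) ler_wpM2r// ltW.
have := dev w (suffix_refl _) wzw; have := dev (z ++ w) wzw (suffix_refl _).
rewrite /delta !ler_norml => /andP[? ?] /andP[? ?].
by apply/andP; split; lra.
Qed.

(** The union bound is taken over the words [v = rcons u a] of each length: the
    bound for [v] is proportional to the probability of [v]. *)
Lemma test_deviant_prob n : (0 < n)%N ->
  (P [set t | test_deviant n (W n.+1 t)] <=
    (4 * n.+2%:R ^+ 3 * expR (- (n%:R `^ (1 - gamma - 2 * beta) / 32)))%:E)%E.
Proof.
move=> n_gt0; have n1 : 1 <= n%:R :> R by rewrite ler1n.
have n0 : 0 < n%:R :> R by rewrite ltr0n.
have /andP[b0 b1] := beta_itv.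
have delta_itv : 0 <= delta n <= 1.
  rewrite divr_ge0 ?powR_ge0//= ler_pdivrMr// mul1r (@le_trans _ _ 1)// ?ler1n//.
  by rewrite -[leRHS](powRr0 n%:R) ler_powR// oppr_le0 ltW.
have exponent : delta n ^+ 2 * m n / 8 = n%:R `^ (1 - gamma - 2 * beta) / 32.
  have -> : 1 - gamma - 2 * beta = (- beta) + ((- beta) + (1 - gamma)) by ring.
  have nz c : (c == 0) ==> ((n%:R : R) != 0) by rewrite gt_eqF// implybT.
  by rewrite powRD ?nz// powRD ?nz// /delta /m; field.
set B := 4 * n.+2%:R ^+ 2 * expR (- (n%:R `^ (1 - gamma - 2 * beta) / 32)).
have B0 : 0 <= B by rewrite !mulr_ge0 ?expR_ge0.
pose E l v := [set t | size v = l /\ exists u a,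
  [/\ v = rcons u a, suffix w u & deviant (q a) (delta n) (m n) u a (W n.+1 t)]].
have mE l v : measurable (E l v).
  exact: (measurable_initial X X_process n.+1 [set s | size v = l /\ exists u a,
    [/\ v = rcons u a, suffix w u & deviant (q a) (delta n) (m n) u a s]]).
have PE l : (P (\bigcup_v E l v) <= B%:E)%E.
  apply: (discrete_union_le P (fun t => W l t)) => //.
    by move=> v; exact: (measurable_initial X X_process l [set v]).
  move=> v.
  have [[vl [u [a [vE wu]]]]|none] := pselect (size v = l /\ exists u a,
      v = rcons u a /\ suffix w u).
    apply: (@le_trans _ _ (P [set t | deviant (q a) (delta n) (m n) u a (W n.+1 t)])).
      rewrite le_measure ?inE//.
        exact: measurable_initial X X_process n.+1 (deviant (q a) (delta n) (m n) u a).
      by move=> t [_ [u' [a' [+ _]]]]; rewrite vE => /rcons_inj[-> ->].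
    have := deviation_prob P X X_process X_stationary u a (q a)
      (cprob_itv a) (next_law _ a wu) (delta n) (m n) n.+1 delta_itv.
    by rewrite exponent -vl initial_prob// vE EFinM.
  rewrite (_ : E l v = set0) ?measure0 ?mule_ge0 ?lee_fin//.
  apply/seteqP; split => // t [vl [u [a [vE wu _]]]]; apply: none.
  by split => //; exists u, a.
have mUE (l : nat) : measurable (\bigcup_v E l v).
  by apply: countable_bigcupT_measurable => //; exact: countableP.
apply: (@le_trans _ _ (P (\big[setU/set0]_(l < n.+2) \bigcup_v E l v))).
  rewrite le_measure ?inE//.
  - exact: measurable_initial X X_process n.+1 (test_deviant n).
  - exact: bigsetU_measurable.
  rewrite -(bigcup_mkord n.+2 (fun l => \bigcup_v E l v)) => t [u [a [wu dev]]].
  exists (size (rcons u a)) => /=.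
    have /and3P[/size_infix + _ _] := dev.
    by rewrite size_initial ltnS.
  by exists (rcons u a) => //; split => //; exists u, a.
have := @Boole_inequality _ _ _ P (fun l => \bigcup_v E l v) n.+2
  (fun l _ => mUE l).
move=> /le_trans; apply.
apply: (@le_trans _ _ (\sum_(l < n.+2) B%:E)%E).
  by apply: (@lee_sum R) => l _; exact: PE.
rewrite sumEFin sumr_const card_ord lee_fin -mulr_natl /B.
by rewrite le_eqVlt; apply/orP; left; apply/eqP; ring.
Qed.

Theorem memory_word_test : {ae P, forall t, \forall n \near \oo,
  PTEST gamma beta n (traj X t) w}.
Proof.
pose F n := [set t | test_deviant n (W n.+1 t)].
have mF n : measurable (F n).
  exact: measurable_initial X X_process n.+1 (test_deviant n).
have /andP[b0 b1] := beta_itv.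
have [||K HK] := @expR_power_decay R (1 - gamma - 2 * beta) 32 _ _; [lra|by []|].
have sumF : (\sum_(n <oo) P (F n) < +oo)%E.
  apply: (@nneseries_telescope _ _ (K + 2)) => // -[|n].
    rewrite (le_trans (probability_le1 P (mF 0%N)))// lee_fin.
    have := HK 0%N; rewrite (_ : 1%:R * 2%:R = 2 :> R) ?mul1r// => HK0.
    rewrite ler_pdivlMr// mul1r -lerBlDr subrr.
    have : 0 <= K / 2 by rewrite (le_trans _ HK0)// !mulr_ge0 ?expR_ge0.
    by rewrite pmulr_lge0// invr_gt0.
  apply: le_trans (test_deviant_prob n.+1 _) _ => //; rewrite lee_fin.
  rewrite (le_trans (HK _))// ler_wpM2r ?invr_ge0 ?mulr_ge0//; lra.
have F0 := lim_sup_set_cvg0 mF sumF.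
exists (lim_sup_set F); split => //.
  apply: bigcapT_measurable => k; apply: bigcup_measurable => j _; exact: mF.
move=> t /= nt k _; apply: contrapT => noF; apply: nt.
exists k => // n /= kn; apply: contrapT => /negP test_no.
apply: noF; exists n => //; exact: test_fails_deviant.
Qed.

End MemoryTest.

(** * Other words fail the test *)

Section Growth.
Context {R : realType}.

Lemma powRN_small (b e : R) : 0 < b -> 0 < e ->
  \forall n \near \oo, n%:R `^ (- b) < e.
Proof.
move=> b0 e0; near=> n.
have n0 : 0 < n%:R :> R by rewrite ltr0n; near: n; exact: nbhs_infty_gt.
have nb : e^-1 `^ b^-1 < n%:R by near: n; exact: nbhs_infty_gtr.
rewrite powRN -[ltRHS]invrK ltf_pV2 ?posrE ?invr_gt0 ?powR_gt0//.
have := @gt0_ltr_powR R b b0 _ _ (powR_ge0 _ _) (ltW n0) nb.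
by rewrite -powRrM mulVf ?gt_eqF// powRr1// invr_ge0 ltW.
Unshelve. all: by end_near.
Qed.

Lemma linear_growth (f : nat -> nat) (gamma l : R) : 0 < gamma -> 0 < l ->
  (f n)%:R / n%:R @[n --> \oo] --> l ->
  \forall n \near \oo, n%:R `^ (1 - gamma) < (f n)%:R.
Proof.
move=> g0 l0 fl; have l2 : l / 2 < l by lra.
near=> n.
have n0 : 0 < n%:R :> R by rewrite ltr0n; near: n; exact: nbhs_infty_gt.
have fn : l / 2 < (f n)%:R / n%:R by near: n; exact: cvgr_gt fl _ l2.
rewrite ltr_pdivlMr// in fn; apply: le_lt_trans fn.
rewrite powRD; last by rewrite (gt_eqF n0) implybT.
rewrite powRr1 ?(ltW n0)// mulrC ler_wpM2r ?(ltW n0)// ltW//.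
by near: n; apply: powRN_small; rewrite // divr_gt0.
Unshelve. all: by end_near.
Qed.

End Growth.

Section TrajectoryFrequency.
Context {R : realType} {A : countType}.
Variables (p : seq A -> R) (x : int -> A).
Hypothesis p_freq : forall v,
  (\sum_(j < n) suffix v (initial x j))%N%:R / n%:R @[n --> \oo] --> p v.
Implicit Types (u v : seq A) (a : A).

Lemma hits_frequency v :
  (hits v (initial x n))%:R / n%:R @[n --> \oo] --> p v.
Proof. by under eq_fun do rewrite hits_initial; exact: p_freq. Qed.

Lemma follows_frequency u a :
  (follows u a (initial x n))%:R / n%:R @[n --> \oo] --> p (rcons u a).
Proof.
under eq_fun do rewrite follows_initial.
apply: cvg_average_bounded (p_freq (rcons u a)) => n; rewrite distrC.
exact: (sum_shift_le (fun j => suffix (rcons u a) (initial x j))).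
Qed.

Lemma freq_cvg u a : p u != 0 ->
  freq u a (initial x n.+1) @[n --> \oo] --> p (rcons u a) / p u.
Proof.
move=> pu; rewrite (cvg_shiftS (fun n => freq u a (initial x n) : R)).
apply: cvg_trans (cvgM (follows_frequency u a) (cvgV pu (hits_frequency u))).
apply: near_eq_cvg; near=> n.
have n0 : n%:R != 0 :> R by rewrite pnatr_eq0 -lt0n; near: n; exact: nbhs_infty_gt.
by rewrite /freq /= invf_div mulrA divfK.
Unshelve. all: by end_near.
Qed.

Lemma test_rejects (gamma beta : R) w z y : 0 < gamma -> 0 < beta ->
  (1 <= size z)%N -> (forall v v', p (v ++ v') <= p v') ->
  (forall v a, p (rcons v a) <= p v) ->
  0 < p (z ++ rcons w y) ->
  p (rcons w y) / p w <> p (rcons (z ++ w) y) / p (z ++ w) ->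
  \forall n \near \oo, ~~ PTEST gamma beta n x w.
Proof.
move=> g0 b0 z1 p_cat p_rcons p_gt0 neq.
have pzw : 0 < p (z ++ w) by rewrite (lt_le_trans p_gt0)// -rcons_cat.
have pw : 0 < p w by rewrite (lt_le_trans pzw).
pose D := `|p (rcons w y) / p w - p (rcons (z ++ w) y) / p (z ++ w)|.
have D0 : 0 < D by rewrite normr_gt0 subr_eq0; exact/eqP.
have D2 : D / 2 < D by lra.
have cvgD : `|freq w y (initial x n.+1) - freq (z ++ w) y (initial x n.+1)|
    @[n --> \oo] --> D.
  by apply: cvg_norm; apply: cvgB; apply: freq_cvg; rewrite gt_eqF.
have growth : \forall n \near \oo,
    n%:R `^ (1 - gamma) < (follows (z ++ w) y (initial x n.+1))%:R :> R.
  have pf : 0 < p (rcons (z ++ w) y) by rewrite rcons_cat.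
  apply: filterS (linear_growth _ _ _ g0 pf (follows_frequency (z ++ w) y)) => n.
  by move=> /lt_le_trans; apply; rewrite ler_nat initialS follows_rcons leq_addr.
near=> n.
apply: (@PTEST_no _ _ gamma beta n x w z y).
- by rewrite z1 /=; near: n; exact: nbhs_infty_ge.
- by near: n.
apply: (@lt_trans _ _ (D / 2)).
  by near: n; apply: powRN_small; rewrite // divr_gt0.
by near: n; exact: cvgr_gt cvgD _ D2.
Unshelve. all: by end_near.
Qed.

End TrajectoryFrequency.

(** * A trajectory on which the tests are consistent *)

Section Least.
Implicit Type Q : nat -> Prop.

Lemma least_some Q : (exists k, Q k) ->
  exists k, [/\ least Q = Some k, Q k & forall j, Q j -> (k <= j)%N].
Proof.
move=> [k0 Qk0]; rewrite /least; case: pselect => [exQ|nexQ]; last first.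
  by case: nexQ; exists k0; apply/asboolP.
case: ex_minnP => k /asboolP Qk k_min; exists k; split => // j Qj.
by apply: k_min; apply/asboolP.
Qed.

Lemma least_eq Q k : Q k -> (forall j, Q j -> (k <= j)%N) -> least Q = Some k.
Proof.
move=> Qk k_min; have [j [-> Qj j_min]] := least_some Q (ex_intro _ k Qk).
by congr Some; apply/eqP; rewrite eqn_leq j_min//= k_min.
Qed.

End Least.

Lemma near_forall_le (Q : nat -> nat -> Prop) J :
  (forall i, \forall n \near \oo, Q i n) ->
  \forall n \near \oo, forall i, (i <= J)%N -> Q i n.
Proof.
move=> HQ; elim: J => [|J IH].
  by apply: filterS (HQ 0%N) => n Qn i; rewrite leqn0 => /eqP ->.
apply: filterS2 IH (HQ J.+1) => n Qn QJ i.
by rewrite leq_eqVlt => /orP[/eqP ->//|]; exact: Qn.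
Qed.

Lemma size_str_to0 {A : countType} (y : int -> A) k : size (str y (- k%:Z + 1) 0) = k.
Proof.
rewrite (_ : 0 = - k%:Z + 1 + k%:Z - 1); last by lia.
by rewrite str_addn size_mkseq.
Qed.

Lemma suffix_str {A : countType} (y : int -> A) k l : (k <= l)%N ->
  suffix (str y (- k%:Z + 1) 0) (str y (- l%:Z + 1) 0).
Proof.
move=> kl; have toE (i : nat) : str y (- i%:Z + 1) 0 =
    mkseq (fun j => y (- i%:Z + 1 + j%:Z)) i.
  by rewrite -str_addn; congr str; lia.
apply/suffixP; exists (mkseq (fun j => y (- l%:Z + 1 + j%:Z)) (l - k)).
rewrite !toE /mkseq -{2}(subnK kl) iotaD map_cat add0n; congr (_ ++ _).
rewrite -(addn0 (l - k)%N) iotaDl -map_comp; apply: eq_map => j /=.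
by congr y; lia.
Qed.

Section Trajectory.
Context {R : realType} {A : countType}.
Variables (gamma beta eps : R) (w : nat -> seq A) (x : int -> A).
Variables (mem : seq A -> Prop) (pr : nat -> R) (J J0 : nat).
Implicit Types (i j k n : nat) (v : seq A).

(** Here [mem] is the set of memory words and [pr j] is the probability that a past
    is remembered at level [j]; the trajectory [x] is fixed, and the hypotheses are
    those that hold almost surely. *)
Definition remembered j k : bool :=
  [exists i : 'I_j.+1, `[< mem (w i) >] && suffix (w i) (initial x k.+1)].

Hypothesis eps_gt0 : 0 < eps.
Hypothesis w_list : word_list w.
Hypothesis test_consistent :
  forall i, \forall n \near \oo, PTEST gamma beta n x (w i) = `[< mem (w i) >].
Hypothesis remembered_frequency : forall j,
  (\sum_(k < n) remembered j k)%N%:R / n%:R @[n --> \oo] --> pr j.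
Hypothesis occ_growth : forall i, \forall n \near \oo,
  suffix (w i) (initial x n.+1) ->
  n%:R `^ (1 - gamma) <= (occ (w i) x 0 n%:Z)%:R.
Hypothesis J_large : 1 - eps / 2 < pr J.
Hypothesis J0_large : 1 - eps < pr J0.
Hypothesis J0_min : forall j, (j < J0)%N -> pr j <= 1 - eps.

Notation test n i := (PTEST gamma beta n x (w i)).
Notation theta n := (theta gamma beta eps w n x).
Notation covered n j := (covered gamma beta w n x j).

Let le_J0J : (J0 <= J)%N.
Proof.
rewrite leqNgt; apply/negP => /J0_min.
by move: J_large eps_gt0; lra.
Qed.

Definition tests_correct n : Prop :=
  forall i, (i <= J)%N -> test n i = `[< mem (w i) >].

Lemma tests_eventually_correct : \forall n \near \oo, tests_correct n.
Proof. exact: near_forall_le test_consistent. Qed.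

Lemma in_Aset n i (k : 'I_n.+1) :
  (k \in Aset w n x i) = suffix (w i) (initial x k.+1).
Proof.
have [w0 _ _ _] := w_list; rewrite /Aset; case: eqP => [->|_].
  by rewrite w0 suffix0s finset.in_setT.
rewrite finset.in_set suffix_initial; congr (_ && _); first by lia.
by congr (str _ _ _ == _); lia.
Qed.

Lemma in_covered n j (k : 'I_n.+1) : tests_correct n -> (j <= J)%N ->
  (k \in covered n j) = remembered j k.
Proof.
move=> ok jJ; apply/finset.bigcupP/existsP => -[i].
  move=> ti; rewrite in_Aset => ki; exists i; rewrite ki andbT -ok//.
  by rewrite (leq_trans _ jJ)// -ltnS.
move=> /andP[mi ki]; exists i; last by rewrite in_Aset.
by rewrite ok// (leq_trans _ jJ)// -ltnS.
Qed.

Lemma card_covered n j : tests_correct n -> (j <= J)%N ->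
  #|covered n j| = (\sum_(k < n.+1) remembered j k)%N.
Proof.
move=> ok jJ; rewrite -sum1_card big_mkcond /=; apply: eq_bigr => k _.
by rewrite in_covered//; case: remembered.
Qed.

Let remembered_frequencyS j :
  (\sum_(k < n.+1) remembered j k)%N%:R / n.+1%:R @[n --> \oo] --> pr j.
Proof.
by rewrite (cvg_shiftS
  (fun n => (\sum_(k < n) remembered j k)%N%:R / n%:R : R)).
Qed.

Lemma theta_le : \forall n \near \oo, (theta n <= J)%N.
Proof.
near=> n.
have ok : tests_correct n by near: n; exact: tests_eventually_correct.
have Jn : (J < n)%N by near: n; exact: nbhs_infty_gt.
rewrite leqNgt; apply/negP => /(before_find 0%N).
rewrite nth_iota// add0n card_covered// => /negP; apply; apply/ltW.
near: n; exact: cvgr_gt (remembered_frequencyS J) _ J_large.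
Unshelve. all: by end_near.
Qed.

Lemma theta_ge : \forall n \near \oo, (J0 <= theta n)%N.
Proof.
have below : \forall n \near \oo, forall j, (j <= J)%N -> (j < J0)%N ->
    (\sum_(k < n.+1) remembered j k)%N%:R / n.+1%:R < 1 - eps / 2.
  apply: near_forall_le => j; have [jJ0|J0j] := ltnP j J0; last first.
    exact: nearW.
  have prj : pr j < 1 - eps / 2 by have := J0_min _ jJ0; move: eps_gt0; lra.
  by apply: filterS (cvgr_lt _ (remembered_frequencyS j) _ prj).
near=> n.
have ok : tests_correct n by near: n; exact: tests_eventually_correct.
have Jn : (J < n)%N by near: n; exact: nbhs_infty_gt.
rewrite leqNgt; apply/negP => tJ0.
have tn : (theta n < n)%N by rewrite (leq_trans tJ0)// (leq_trans le_J0J)// ltnW.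
have : has (fun j => 1 - eps / 2 <= #|covered n j|%:R / n.+1%:R) (iota 0 n).
  by rewrite has_find size_iota.
move=> /(nth_find 0%N); rewrite -/(theta n) nth_iota// add0n.
have tJ : (theta n <= J)%N by rewrite (leq_trans (ltnW tJ0)).
rewrite card_covered// leNgt => /negP; apply.
by have := tJ0; have := tJ; move: (theta n); near: n.
Unshelve. all: by end_near.
Qed.

Lemma calN_remembered : \forall n \near \oo,
  calN gamma beta eps w x n -> remembered J n.
Proof.
near=> n.
have ok : tests_correct n by near: n; exact: tests_eventually_correct.
have tJ : (theta n <= J)%N by near: n; exact: theta_le.
rewrite /calN in_covered// => /existsP[i Hi].
by apply/existsP; exists (widen_ord (n := (theta n).+1) (m := J.+1) tJ i).
Unshelve. all: by end_near.
Qed.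

Lemma remembered_calN : \forall n \near \oo,
  remembered J0 n -> calN gamma beta eps w x n.
Proof.
near=> n.
have ok : tests_correct n by near: n; exact: tests_eventually_correct.
have tJ : (theta n <= J)%N by near: n; exact: theta_le.
have J0t : (J0 <= theta n)%N by near: n; exact: theta_ge.
rewrite /calN in_covered// => /existsP[i Hi].
by apply/existsP; exists (widen_ord (n := J0.+1) (m := (theta n).+1) J0t i).
Unshelve. all: by end_near.
Qed.

(** The index [kappa] is least among all words that end at time [n] and pass the
    test; being at most [J], where tests and memory agree, it is also least among
    the memory words that end at time [n]. *)
Lemma kappa_spec : \forall n \near \oo, calN gamma beta eps w x n ->
  let k := kappa gamma beta w n x in
  [/\ (k <= J)%N, mem (w k), suffix (w k) (initial x n.+1),
      str x (n%:Z - (size (w k))%:Z + 1) n%:Z = w k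
    & forall i, mem (w i) -> str x (n%:Z - (size (w i))%:Z + 1) n%:Z = w i ->
        (k <= i)%N].
Proof.
have sizes : \forall n \near \oo, forall i, (i <= J)%N -> (size (w i) <= n)%N.
  by apply: near_forall_le => i; exact: nbhs_infty_ge.
apply: filterS3 calN_remembered tests_eventually_correct sizes => n rem ok sz.
have endE i : (i <= J)%N -> suffix (w i) (initial x n.+1) =
    (str x (n%:Z - (size (w i))%:Z + 1) n%:Z == w i).
  move=> iJ; rewrite suffix_initial leqW ?sz//=.
  by congr (str _ _ _ == _); lia.
move=> /rem /existsP[i /andP[mi si]] /=.
have iJ : (i <= J)%N by rewrite -ltnS.
pose Q i := str x (n%:Z - (size (w i))%:Z + 1) n%:Z = w i /\ test n i.
have Qi : Q i by split; [apply/eqP; rewrite -endE|rewrite ok].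
have [k [kE [strk testk] k_min]] := least_some Q (ex_intro _ (i : nat) Qi).
rewrite /kappa -/Q kE /=.
have kJ : (k <= J)%N by rewrite (leq_trans _ iJ)// k_min.
have memk : mem (w k) by apply/asboolP; rewrite -ok.
split => //; first by rewrite endE// strk.
move=> i' mi' stri'; have [i'J|Ji'] := leqP i' J; last first.
  by rewrite (leq_trans kJ)// ltnW.
by apply: k_min; split => //; rewrite ok//; apply/asboolP.
Qed.

(** The suffixes of a word precede it in the list, so the first word of the list
    that is remembered and ends at time [n] is also the shortest one. *)
Lemma rho_memory_length : \forall n \near \oo, calN gamma beta eps w x n ->
  least (fun K => mem (str (time_shift n%:Z x) (- K%:Z + 1) 0))
    = Some (rho gamma beta w n x).
Proof.
have [_ w_inj w_surj w_suffix] := w_list.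
apply: filterS kappa_spec => n spec /spec.
rewrite /rho; set k := kappa _ _ _ _ _ => -[kJ memk _ strk k_min].
have endE i : str (time_shift n%:Z x) (- i%:Z + 1) 0 = str x (n%:Z - i%:Z + 1) n%:Z.
  by rewrite str_shift; congr str; lia.
apply: least_eq; first by rewrite endE strk.
move=> K; set v := str _ _ _ => memv; rewrite leqNgt; apply/negP => Kk.
have [i iv] := w_surj v.
have vK : size v = K by exact: size_str_to0.
have ik : (i <= k)%N.
  apply: w_suffix; rewrite iv -strk -endE; apply: suffix_str.
  by rewrite ltnW.
have ki : (k <= i)%N by apply: k_min; rewrite iv ?vK -?endE.
have ikE : i = k by apply/eqP; rewrite eqn_leq ik ki.
by move: Kk; rewrite -ikE iv vK ltnn.
Qed.

Lemma rho_occ : \forall n \near \oo, calN gamma beta eps w x n ->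
  n%:R `^ (1 - gamma) <=
    (occ (str x (n%:Z - (rho gamma beta w n x)%:Z + 1) n%:Z) x 0 n%:Z)%:R.
Proof.
have growth : \forall n \near \oo, forall i, (i <= J)%N ->
    suffix (w i) (initial x n.+1) ->
    n%:R `^ (1 - gamma) <= (occ (w i) x 0 n%:Z)%:R :> R.
  exact: near_forall_le.
apply: filterS2 growth kappa_spec => n growth_n spec /spec.
by rewrite /rho => -[kJ _ sk -> _]; exact: growth_n.
Qed.

Lemma calN_density : ((1 - eps)%:E <= limn_einf (fun n : nat =>
  (#|[set m : 'I_n | calN gamma beta eps w x m]%SET|%:R / n%:R)%:E))%E.
Proof.
have [M _ HM] := remembered_calN.
have cvg_both : (\sum_(k < n) (remembered J0 k && calN gamma beta eps w x k))%N%:R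
    / n%:R @[n --> \oo] --> pr J0.
  apply: (@frequency_eventually_eq _ (remembered J0)
    (fun k => remembered J0 k && calN gamma beta eps w x k) M _ _
    (remembered_frequency J0)).
  by move=> k Mk; have := HM k Mk; case: remembered => //= ->.
have [N _ HN] := cvgr_gt _ cvg_both _ J0_large.
rewrite limn_einf_lim (cvg_lim _ (@cvg_einfs_sup R _))//.
apply: (@le_trans _ _ (einfs (fun n : nat =>
  (#|[set m : 'I_n | calN gamma beta eps w x m]%SET|%:R / n%:R)%:E) N)); last first.
  by apply: ereal_sup_ubound; exists N.
apply: le_ereal_inf_tmp => _ [n /= Nn <-]; rewrite lee_fin ltW//.
apply: lt_le_trans (HN n Nn) _; rewrite ler_wpM2r ?invr_ge0// ler_nat.
rewrite -sum1_card [leqRHS]big_mkcond /=; apply: leq_sum => k _.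
by rewrite finset.in_set; case: remembered; case: calN.
Qed.

End Trajectory.

(** * Almost every trajectory *)

Section AlmostSure.
Context {d : measure_display} {T : measurableType d} {R : realType}.
Context {A : countType} (P : probability T R) (X : int -> T -> A).
Variables (gamma beta eps : R) (w : nat -> seq A).
Hypothesis X_process : is_process X.
Hypothesis X_stationary : stationary P X.
Hypothesis X_ergodic : ergodic P X.
Hypothesis gamma_itv : 0 < gamma < 1.
Hypothesis beta_itv : 0 < beta < (1 - gamma) / 2.
Hypothesis w_list : word_list w.
Implicit Types (t : T) (v : seq A) (i j n : nat).

Notation p v := (prob P X v).
Notation x t := (traj X t).
Notation mem := (memory_word P X).

Lemma ae_word_frequency : {ae P, forall t, forall v,
  (\sum_(j < n) suffix v (initial (x t) j))%N%:R / n%:R @[n --> \oo] --> p v}.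
Proof.
have [_ _ w_surj _] := w_list.
have := @ae_foralln _ _ _ P (fun i t =>
  (\sum_(j < n) suffix (w i) (initial (x t) j))%N%:R / n%:R @[n --> \oo] --> p (w i)).
move=> /(_ (fun i => word_frequency P X X_process X_stationary X_ergodic (w i))).
by apply: filterS => t Ht v; have [i <-] := w_surj v.
Qed.

Lemma ae_test_consistent : {ae P, forall t, forall i,
  \forall n \near \oo, PTEST gamma beta n (x t) (w i) = `[< mem (w i) >]}.
Proof.
have /andP[g0 _] := gamma_itv; have /andP[b0 _] := beta_itv.
apply/ae_foralln => i; have [mi|nmi] := pselect (mem (w i)).
  apply: filterS (memory_word_test P X X_process X_stationary gamma beta beta_itv (w i) mi).
  by move=> t; apply: filterS => n ->; apply/esym/asboolP.
apply: filterS ae_word_frequency => t freq_t.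
have [z [y [z1 [p0 neq]]]] : exists z y, (1 <= size z)%N /\
    0 < p (z ++ rcons (w i) y) /\ cprob P X y (w i) <> cprob P X y (z ++ w i).
  apply: contrapT => no; apply: nmi => z y z1 p0; apply: contrapT => neq.
  by apply: no; exists z, y.
rewrite !(cprobE P X X_stationary) in neq.
apply: filterS (test_rejects _ _ freq_t gamma beta (w i) z y g0 b0 z1 _ _ p0 neq).
- by move=> n /negbTE ->; apply/esym/asboolP.
- by move=> v v'; exact: prob_cat.
- by move=> v a; exact: prob_rcons.
Qed.

(** A word of positive probability occurs linearly often, and a word of probability
    zero almost surely never occurs. *)
Lemma ae_occ_growth : {ae P, forall t, forall i, \forall n \near \oo,
  suffix (w i) (initial (x t) n.+1) ->
  n%:R `^ (1 - gamma) <= (occ (w i) (x t) 0 n%:Z)%:R :> R}.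
Proof.
have /andP[g0 _] := gamma_itv.
apply/ae_foralln => i; have := prob_ge0 P X (w i).
rewrite le_eqVlt => /orP[/eqP p0|p_gt0]; last first.
  apply: filterS ae_word_frequency => t /(_ (w i)) freq_t.
  apply: filterS (linear_growth _ _ _ g0 p_gt0 freq_t) => n n_lt _.
  rewrite (le_trans (ltW n_lt))// ler_nat -[n%:Z](addrK 1) -PoszD addn1.
  by rewrite occ_initial !big_ord_recr /= -addnA leq_addr.
have /ae_foralln : forall n, {ae P, forall t, ~ suffix (w i) (initial (x t) n)}.
  move=> n; exists [set t | suffix (w i) (initial (x t) n)]; split.
  - exact: suffix_event.
  - have [wn|nw] := leqP (size (w i)) n; first by rewrite suffix_probE// -p0.
    rewrite (_ : [set t | _] = set0) ?measure0//.
    apply/seteqP; split => // t /= /size_suffix.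
    by rewrite size_initial leqNgt nw.
  - by move=> t /= /contrapT.
by apply: filterS => t never; apply: nearW => n /never.
Qed.

Definition remembered_paths j : set (int -> A) :=
  [set y | exists2 i, (i <= j)%N & mem (w i) /\ ending (w i) y].

Lemma remembered_paths_sigma j : path_sigma (remembered_paths j).
Proof.
pose a0 := X 0 point.
have -> : remembered_paths j =
    \bigcup_(i in [set i | (i <= j)%N /\ mem (w i)]) ending (w i).
  by apply/seteqP; split => [y [i ij [mi ei]]|y [i [ij mi] ei]]; exists i.
apply: (@bigcup_measurable _ (paths A a0)) => i _.
exact: ending_sigma.
Qed.

Definition remembered_prob j : R := fine (P (traj X @^-1` remembered_paths j)).

Lemma ae_remembered_frequency : {ae P, forall t, forall j,
  (\sum_(k < n) remembered w (x t) mem j k)%N%:R / n%:R @[n --> \oo]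
    --> remembered_prob j}.
Proof.
apply/ae_foralln => j.
have := frequency P X X_process X_stationary X_ergodic _ (remembered_paths_sigma j).
apply: filterS => t freq_t.
apply: (@frequency_eventually_eq _
  (fun k => time_shift k%:Z (x t) \in remembered_paths j)
  (remembered w (x t) mem j) (\max_(i < j.+1) size (w i))%N _ _ freq_t) => k Lk.
(* from then on the window holds each of the words [w 0, ..., w j] *)
have sz i : (i <= j)%N -> (size (w i) <= k.+1)%N.
  move=> ij; rewrite leqW// (leq_trans _ Lk)//.
  exact: (leq_bigmax (Ordinal (ij : (i < j.+1)%N))).
apply/idP/existsP.
  rewrite inE => -[i ij [mi /(ending_initial _ _ _ (sz _ ij)) si]].
  by exists (Ordinal (ij : (i < j.+1)%N)); rewrite si andbT; apply/asboolP.
move=> [i /andP[/asboolP mi si]]; rewrite inE.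
have ij : (i <= j)%N by rewrite -ltnS.
by exists i => //; split => //; apply/(ending_initial _ _ _ (sz _ ij)).
Qed.

(** Almost every past ends with a memory word, so the events increase to an event of
    probability one. *)
Lemma remembered_prob_large (c : R) : finitarily_markovian P X -> c < 1 ->
  exists j, c < remembered_prob j.
Proof.
move=> fin_markov c1; have [_ _ w_surj _] := w_list.
pose B j := traj X @^-1` remembered_paths j.
have mB j : measurable (B j).
  exact: measurable_event _ X_process _ (remembered_paths_sigma j).
have mUB : measurable (\bigcup_j B j) by exact: bigcupT_measurable.
have B_nd : nondecreasing_seq B.
  move=> j j' jj'; apply/subsetPset => t [i ij Hi].
  by exists i => //; rewrite (leq_trans ij).
have PB1 : P (\bigcup_j B j) = 1%E.
  have [N [mN N0 HN]] := fin_markov.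
  have P0 : P (~` \bigcup_j B j) = 0%E.
    apply/eqP; rewrite eq_le measure_ge0 andbT -N0 le_measure ?inE//.
      exact: measurableC.
    move=> t nB; apply: HN => /= finite_memory; apply: nB.
    have [K memK] : exists K, is_memory P X (x t) K.
      apply: contrapT => noK; apply: finite_memory.
      rewrite /memory_length /least; case: pselect => [exK|//]; exfalso.
      by case: exK => K /asboolP memK; apply: noK; exists K.
    have [i iE] := w_surj (str (x t) (- K%:Z + 1) 0).
    exists i => //; exists i => //; rewrite /ending /= iE; split => //.
    by rewrite size_str_to0.
  by rewrite -[X in P X]setCK probability_setC ?P0 ?sube0//; exact: measurableC.
have cvgB : P (B j) @[j --> \oo] --> 1%:E.
  by rewrite -PB1; exact: nondecreasing_cvg_mu.
have /filter_ex[j] : \forall j \near \oo, c < fine (P (B j)).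
  by apply: cvgr_gt c1; exact: fine_cvg.
by exists j.
Qed.

End AlmostSure.

Theorem theorem4 (R : realType) (d : measure_display) (T : measurableType d)
    (P : probability T R) (A : countType) (X : int -> T -> A)
    (gamma beta eps : R) (w : nat -> seq A)
    (X_process : is_process X)
    (X_stationary : stationary P X)
    (X_ergodic : ergodic P X)
    (X_finitarily_markovian : finitarily_markovian P X)
    (gamma_itv : 0 < gamma < 1)
    (beta_itv : 0 < beta < (1 - gamma) / 2)
    (eps_gt0 : 0 < eps)
    (w_list : word_list w) :
  [/\ {ae P, forall t, \forall n \near \oo,
        calN gamma beta eps w (traj X t) n ->
        memory_length P X (time_shift n%:Z (traj X t))
          = Some (rho gamma beta w n (traj X t))},
      {ae P, forall t,
        ((1 - eps)%:E <= limn_einf (fun n : nat =>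
          (#|[set m : 'I_n | calN gamma beta eps w (traj X t) m]%SET|%:R
            / n%:R)%:E))%E}
    & {ae P, forall t, \forall n \near \oo,
        calN gamma beta eps w (traj X t) n ->
        n%:R `^ (1 - gamma) <=
          (occ (str (traj X t)
                  (n%:Z - (rho gamma beta w n (traj X t))%:Z + 1) n%:Z)
               (traj X t) 0 n%:Z)%:R} ].
Proof.
pose pr := remembered_prob P X w.
have [J J_large] : exists J, 1 - eps / 2 < pr J.
  by apply: remembered_prob_large => //; lra.
have [J0 J0_large J0_min] : exists2 J0, 1 - eps < pr J0 &
    forall j, (j < J0)%N -> pr j <= 1 - eps.
  have exJ0 : exists j, 1 - eps < pr j by apply: remembered_prob_large => //; lra.
  exists (ex_minn exJ0); case: ex_minnP => // J0 J0_large J0_min j jJ0.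
  by rewrite leNgt; apply: contraL jJ0 => /J0_min; rewrite -leqNgt.
have tests := ae_test_consistent P X gamma beta w
  X_process X_stationary X_ergodic gamma_itv beta_itv w_list.
have freqs := ae_remembered_frequency P X w X_process X_stationary X_ergodic.
have growth := ae_occ_growth P X gamma w
  X_process X_stationary X_ergodic gamma_itv w_list.
split.
- apply: filterS3 tests freqs growth => t tests freqs growth.
  exact: (rho_memory_length _ _ _ _ _ _ _ _ _ eps_gt0 w_list tests freqs
    J_large J0_large J0_min).
- apply: filterS3 tests freqs growth => t tests freqs growth.
  exact: (calN_density _ _ _ _ _ _ _ _ _ eps_gt0 w_list tests freqs
    J_large J0_large J0_min).
- apply: filterS3 tests freqs growth => t tests freqs growth.
  exact: (rho_occ _ _ _ _ _ _ _ _ _ eps_gt0 w_list tests freqs growth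
    J_large J0_large J0_min).
Qed.
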